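(* Let $p\ge 3L_f$, $\rho\ge 0$ and $c<1/(L_f+\rho\sigma_{\max}^2(A)+p)$. Then there exist $\alpha',\beta'>0$ (depending on $L_f,A,G,p,\rho,c$ only) such that for all $\alpha<\alpha'$, $\beta<\beta'$ the following results hold for the sequence $\{(x^t,y^t,z^t)\}$ generated by the S-prox-ALM algorithm with these parameters: 1. Every limit point of $\{(x^t,y^t)\}$ is a KKT point of the problem of minimizing $f(x)$ subject to $Ax=b$, $x\in P$. 2. There exists a constant $B>0$, only depending on $p,\rho,c,\alpha,\beta,L_f,A,G,\underline f,f(x^0)$, such that for any $\epsilon>0$ we can find an $\epsilon$-stationary solution within $B/\epsilon^2$ iterations. In other words, for any integer $t>0$, we can find an $s\in\{0,1,\dots,t-1\}$ such that $(x^{s+1},y^{s+1})$ is a $\sqrt{B}/\sqrt{t}$-stationary solution of the problem.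
   Context: Problem: minimize $f(x)$ subject to $Ax=b$, $x\in P$, where $P=\{x\in\mathbb R^n: Gx\preceq h\}$ is polyhedral (componentwise inequality), $A\in\mathbb R^{m\times n}$, $G\in\mathbb R^{l\times n}$, $b\in\mathbb R^m$, $h\in\mathbb R^l$. $\sigma_{\max}(A)$ is the largest singular value of $A$; norms are Euclidean; $[\cdot]_+$ is the projection onto $P$. Assumptions on $f$ (possibly nonconvex): $f$ is smooth, $\|\nabla f(x)-\nabla f(x')\|\le L_f\|x-x'\|$ for all $x,x'\in P$, and $f(x)>\underline f>-\infty$ for all $x\in P$ with $Ax=b$, for some constant $\underline f$. KKT point: a pair $(x,y)$ such that for some $\mu\in\mathbb R^l$: $\nabla f(x)+A^Ty+G^T\mu=0$, $Ax-b=0$, $Gx\preceq h$, $\mu\succeq 0$, $\mu_i(Gx-h)_i=0$ for $i=1,\dots,l$. $\epsilon$-stationary solution: a pair $(x,y)$ such that $\|Ax-b\|\le\epsilon$ and there exists $v\in\nabla f(x)+A^Ty+\partial\iota(x)$ with $\|v\|\le\epsilon$, where $\iota$ is the indicator function of $P$ ($0$ on $P$, $\infty$ elsewhere) and $\partial\iota(x)$ is its subdifferential at $x$. Let $L_\rho(x;y)=f(x)+y^T(Ax-b)+\frac{\rho}{2}\|Ax-b\|^2$ and $K(x,z;y)=L_\rho(x;y)+\frac p2\|x-z\|^2$, where $p>L_f$ is a positive constant. S-prox-ALM algorithm (parameters $\rho$, $p$, $c>0$, $\alpha>0$, $0<\beta\le 1$): initialize $x^0,z^0,y^0$; for $t=0,1,2,\dots$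 set $y^{t+1}=y^t+\alpha(Ax^t-b)$; $x^{t+1}=[x^t-c\nabla_xK(x^t,z^t;y^{t+1})]_+$; $z^{t+1}=z^t+\beta(x^{t+1}-z^t)$.
   Formalization: Adds β ≤ κα, with κ>0 depending only on L_f, A, G, p, ρ, c, and a nonempty feasible set; B exists for each run, and for x⁰ in P is uniform but also depends on a bound for ‖∇f(x⁰)‖, ‖y⁰‖, ‖x⁰−z⁰‖, ‖Ax⁰−b‖. As stated the claim is false. *)

(* Defs.v *)
From HB Require Import structures.
From mathcomp Require Import all_boot all_order all_algebra.
From mathcomp Require Import all_classical all_reals all_analysis.
Set Implicit Arguments.
Unset Strict Implicit.
Unset Printing Implicit Defensive.
Import Order.TTheory GRing.Theory Num.Theory.
Import numFieldNormedType.Exports.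
Local Open Scope classical_set_scope.
Local Open Scope ring_scope.

Section Defs.
Context {R : realType}.

Definition dot {n} (u v : 'cV[R]_n) : R := \sum_(i < n) u i 0 * v i 0.

(* The norm [`|_|] carried by ['cV[R]_n] in MathComp-Analysis is the max norm;
   the Euclidean one induces the same topology and differentials. *)
Definition enorm {n} (u : 'cV[R]_n) : R := Num.sqrt (dot u u).

Definition singular_values {m n} (A : 'M[R]_(m, n)) : set R :=
  [set Num.sqrt a | a in [set a | eigenvalue (A^T *m A) a]].

(* A maximum, as there are finitely many singular values (0 if n = 0). *)
Definition sigma_max {m n} (A : 'M[R]_(m, n)) : R := sup (singular_values A).

(* Vector of partial derivatives; it represents ['d f x] when
   [differentiable f x]. *)
Definition grad {n} (f : 'cV[R]_n -> R) (x : 'cV[R]_n) : 'cV[R]_n :=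
  \col_(i < n) 'D_(delta_mx i 0) f x.

Definition polyhedron {l n} (G : 'M[R]_(l, n)) (h : 'cV[R]_l) :
    set 'cV[R]_n :=
  [set x | forall i, (G *m x) i 0 <= h i 0].

Definition feasible {m n l} (A : 'M[R]_(m, n)) (b : 'cV[R]_m)
    (G : 'M[R]_(l, n)) (h : 'cV[R]_l) : set 'cV[R]_n :=
  [set x | A *m x = b] `&` polyhedron G h.

Definition is_projection {n} (P : set 'cV[R]_n) (u w : 'cV[R]_n) : Prop :=
  P w /\ forall w', P w' -> enorm (u - w) <= enorm (u - w').

Definition indicator {n} (P : set 'cV[R]_n) (x : 'cV[R]_n) : \bar R :=
  if x \in P then 0%E else +oo%E.

Definition subdifferential {n} (g : 'cV[R]_n -> \bar R) (x : 'cV[R]_n) :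
    set 'cV[R]_n :=
  [set xi | forall x', (g x + (dot xi (x' - x))%:E <= g x')%E].

(* Smoothness is only required as differentiability; continuity of the gradient
   on the polyhedron follows from the Lipschitz bound. *)
Definition admissible {m n l} (A : 'M[R]_(m, n)) (b : 'cV[R]_m)
    (G : 'M[R]_(l, n)) (h : 'cV[R]_l) (f : 'cV[R]_n -> R) (Lf f_lb : R) :
    Prop :=
  [/\ feasible A b G h !=set0,
      forall x, differentiable f x,
      forall x x', polyhedron G h x -> polyhedron G h x' ->
        enorm (grad f x - grad f x') <= Lf * enorm (x - x')
    & forall x, feasible A b G h x -> f_lb < f x].

Definition KKT_point {m n l} (A : 'M[R]_(m, n)) (b : 'cV[R]_m)
    (G : 'M[R]_(l, n)) (h : 'cV[R]_l) (f : 'cV[R]_n -> R)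
    (x : 'cV[R]_n) (y : 'cV[R]_m) : Prop :=
  exists mu : 'cV[R]_l,
    [/\ grad f x + A^T *m y + G^T *m mu = 0,
        A *m x - b = 0,
        forall i, (G *m x) i 0 <= h i 0,
        forall i, 0 <= mu i 0
      & forall i, mu i 0 * (G *m x - h) i 0 = 0].

Definition eps_stationary {m n l} (A : 'M[R]_(m, n)) (b : 'cV[R]_m)
    (G : 'M[R]_(l, n)) (h : 'cV[R]_l) (f : 'cV[R]_n -> R) (eps : R)
    (x : 'cV[R]_n) (y : 'cV[R]_m) : Prop :=
  enorm (A *m x - b) <= eps /\
  exists2 xi, subdifferential (indicator (polyhedron G h)) x xi
            & enorm (grad f x + A^T *m y + xi) <= eps.

Definition aug_lagrangian {m n} (A : 'M[R]_(m, n)) (b : 'cV[R]_m)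
    (f : 'cV[R]_n -> R) (rho : R) (x : 'cV[R]_n) (y : 'cV[R]_m) : R :=
  f x + dot y (A *m x - b) + rho / 2 * enorm (A *m x - b) ^+ 2.

Definition prox_aug_lagrangian {m n} (A : 'M[R]_(m, n)) (b : 'cV[R]_m)
    (f : 'cV[R]_n -> R) (rho p : R) (x z : 'cV[R]_n) (y : 'cV[R]_m) : R :=
  aug_lagrangian A b f rho x y + p / 2 * enorm (x - z) ^+ 2.

(* The starting point (x 0, y 0, z 0) is arbitrary. *)
Definition sprox_alm {m n l} (A : 'M[R]_(m, n)) (b : 'cV[R]_m)
    (G : 'M[R]_(l, n)) (h : 'cV[R]_l) (f : 'cV[R]_n -> R)
    (rho p c alpha beta : R)
    (x : nat -> 'cV[R]_n) (y : nat -> 'cV[R]_m) (z : nat -> 'cV[R]_n) : Prop :=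
  forall t,
    [/\ y t.+1 = y t + alpha *: (A *m x t - b),
        is_projection (polyhedron G h)
          (x t - c *: grad (fun u =>
             prox_aug_lagrangian A b f rho p u (z t) (y t.+1)) (x t))
          (x t.+1)
      & z t.+1 = z t + beta *: (x t.+1 - z t)].

(* [s%:R < B / eps ^+ 2] says that the index s.+1 of the returned iterate is at
   most the ceiling of [B / eps ^+ 2]. *)
Definition stationary_rate {m n l} (A : 'M[R]_(m, n)) (b : 'cV[R]_m)
    (G : 'M[R]_(l, n)) (h : 'cV[R]_l) (f : 'cV[R]_n -> R)
    (x : nat -> 'cV[R]_n) (y : nat -> 'cV[R]_m) (B : R) : Prop :=
  (forall eps : R, 0 < eps -> exists2 s : nat, s%:R < B / eps ^+ 2
     & eps_stationary A b G h f eps (x s.+1) (y s.+1)) /\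
  (forall t : nat, (0 < t)%N -> exists2 s : nat, (s < t)%N
     & eps_stationary A b G h f (Num.sqrt B / Num.sqrt t%:R)
         (x s.+1) (y s.+1)).

(* Size of the starting data, on which the complexity constant depends besides
   f (x 0): the value f (x 0) alone controls neither grad f (x 0) nor the
   distances between x 0, z 0 and the feasible set. *)
Definition start_bounded {m n l} (A : 'M[R]_(m, n)) (b : 'cV[R]_m)
    (G : 'M[R]_(l, n)) (h : 'cV[R]_l) (f : 'cV[R]_n -> R) (r : R)
    (x0 : 'cV[R]_n) (y0 : 'cV[R]_m) (z0 : 'cV[R]_n) : Prop :=
  polyhedron G h x0 /\
  [/\ enorm (grad f x0) <= r, enorm y0 <= r, enorm (x0 - z0) <= r
    & enorm (A *m x0 - b) <= r].

End Defs.

(* Main.v *)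
Require Import Defs.
From mathcomp Require Import all_boot all_order all_algebra.
From mathcomp Require Import all_classical all_reals all_analysis.
From mathcomp Require Import ring lra.
Set Implicit Arguments.
Unset Strict Implicit.
Unset Printing Implicit Defensive.
Import Order.TTheory GRing.Theory Num.Theory.
Import numFieldNormedType.Exports.
Local Open Scope classical_set_scope.
Local Open Scope ring_scope.

(** Write [K (x, z; y)] for the proximal augmented Lagrangian. Since [Lf < p], it
    is strongly convex in [x] on the polyhedron [P], with modulus [p - Lf], even
    though [f] is not convex. So it has a unique minimiser [xbar (y, z)] over
    [P] and, over the feasible set, where [K] is constant in [y], a unique
    minimiser [xstar z]. Let [d (y, z)] and [M z] be the two minimal values.
    Along a run the primal variable decreases [K], the dual variable increases
    [d], and the centre [z] follows a gradient-like step for [M], so the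
    potential
      [K - 2 d + 2 M = (K - d) + (M - d) + M]
    is a natural quantity to watch. Its first two terms are nonnegative and the
    last is at least the lower bound of [f] on the feasible set, so it is bounded
    below.

    With [x', y', z'] the successors of [x, y, z] and [r = A xbar (y', z) - b],
    one step lowers the potential by a multiple of
    [|x - x'|^2 + |x' - z|^2 + |r|^2] (lemma [potential_descent]), provided that
    the distances [|x - xbar|] and [|xbar - xstar|] can be charged to [|x - x'|]
    and [|r|]. The first is a standard estimate for a projected gradient step
    ([primal_error_bound]).

    The second is the dual error bound ([dual_error_bound]), which carries the
    proof. Both [xbar] and [xstar] minimise the same strongly convex function
    over sets [{A x = b'} `&` P] that differ in the right-hand side only, so it
    suffices that this minimiser is Lipschitz in [b'], with a constant that
    depends on [A], [G] and the moduli of the function only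
    ([perturbation_bound]). Move [b'] along a segment. At two points whose
    inequality multipliers have the same support, the estimate is linear algebra,
    with a constant for each of the finitely many supports. The support may change very often, but monotony
    of the multipliers along the segment makes the minimiser Hoelder continuous;
    a chain along a fine grid that jumps from the last visit of a support to the
    next grid point then uses at most one small jump for each support, and the
    jumps vanish as the grid is refined.

    The three quantities above bound the residuals of the KKT system at
    [(x', y')] ([step_eps_stationary]). Summing the decrease gives the rate, with
    a constant controlled by the data at the starting point; it also makes the
    residuals tend to 0, so that limit points satisfy a variational inequality,
    from which Farkas' lemma recovers the multipliers of the inequalities. *)

(** * Euclidean inner product and norm *)

Section Euclid.
Context {R : realType}.
Implicit Types (k : R).

Lemma dotC n (u v : 'cV[R]_n) : dot u v = dot v u.
Proof. by apply: eq_bigr => i _; rewrite mulrC. Qed.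

Lemma dotDl n (u v w : 'cV[R]_n) : dot (u + v) w = dot u w + dot v w.
Proof. by rewrite -big_split; apply: eq_bigr => i _; rewrite mxE mulrDl. Qed.

Lemma dotZl n k (u v : 'cV[R]_n) : dot (k *: u) v = k * dot u v.
Proof. by rewrite mulr_sumr; apply: eq_bigr => i _; rewrite mxE mulrA. Qed.

Lemma dotNl n (u v : 'cV[R]_n) : dot (- u) v = - dot u v.
Proof. by rewrite -scaleN1r dotZl mulN1r. Qed.

Lemma dotDr n (u v w : 'cV[R]_n) : dot w (u + v) = dot w u + dot w v.
Proof. by rewrite dotC dotDl !(dotC w). Qed.

Lemma dotZr n k (u v : 'cV[R]_n) : dot v (k *: u) = k * dot v u.
Proof. by rewrite dotC dotZl dotC. Qed.

Lemma dotNr n (u v : 'cV[R]_n) : dot v (- u) = - dot v u.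
Proof. by rewrite dotC dotNl dotC. Qed.

Lemma dot0l n (v : 'cV[R]_n) : dot 0 v = 0.
Proof. by rewrite -(scale0r 0) dotZl mul0r. Qed.

Lemma dot0r n (v : 'cV[R]_n) : dot v 0 = 0.
Proof. by rewrite dotC dot0l. Qed.

Definition dotE := (dotDl, dotDr, dotNl, dotNr, dotZl, dotZr).

Lemma dot_mulmxr m n (A : 'M[R]_(m, n)) u v : dot u (A *m v) = dot (A^T *m u) v.
Proof.
rewrite /dot (eq_bigr (fun i => \sum_j u i 0 * (A i j * v j 0))); last first.
  by move=> i _; rewrite mxE mulr_sumr.
rewrite exchange_big; apply: eq_bigr => j _ /=.
by rewrite mxE mulr_suml; apply: eq_bigr => i _; rewrite mxE; ring.
Qed.

Lemma dot_mulmxl m n (A : 'M[R]_(m, n)) u v : dot (A *m v) u = dot v (A^T *m u).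
Proof. by rewrite dotC dot_mulmxr dotC. Qed.

Lemma dot_col_mx m1 m2 (u1 v1 : 'cV[R]_m1) (u2 v2 : 'cV[R]_m2) :
  dot (col_mx u1 u2) (col_mx v1 v2) = dot u1 v1 + dot u2 v2.
Proof.
rewrite /dot big_split_ord /=; congr (_ + _); apply: eq_bigr => i _.
  by rewrite !col_mxEu.
by rewrite !col_mxEd.
Qed.

Lemma dot_deltal n (v : 'cV[R]_n) i : dot (delta_mx i 0) v = v i 0.
Proof.
rewrite /dot (bigD1 i) //= big1 ?mxE ?eqxx ?mul1r ?addr0 // => j /negPf ji.
by rewrite mxE ji mul0r.
Qed.

Lemma dot_ge0 n (u : 'cV[R]_n) : 0 <= dot u u.
Proof. by apply: sumr_ge0 => i _; rewrite -expr2 sqr_ge0. Qed.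

Lemma dot_eq0 n (u : 'cV[R]_n) : dot u u = 0 -> u = 0.
Proof.
move=> /eqP; rewrite psumr_eq0 => [/allP u0|i _]; last by rewrite -expr2 sqr_ge0.
apply/colP => i; rewrite mxE; apply/eqP.
by have := u0 i (mem_index_enum _); rewrite -expr2 sqrf_eq0.
Qed.

Lemma enorm_ge0 n (u : 'cV[R]_n) : 0 <= enorm u.
Proof. exact: sqrtr_ge0. Qed.

Lemma sqr_enorm n (u : 'cV[R]_n) : enorm u ^+ 2 = dot u u.
Proof. by rewrite sqr_sqrtr // dot_ge0. Qed.

Lemma enorm0 n : enorm (0 : 'cV[R]_n) = 0.
Proof. by rewrite /enorm dot0l sqrtr0. Qed.

Lemma enorm_eq0 n (u : 'cV[R]_n) : enorm u = 0 -> u = 0.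
Proof. by move=> u0; apply: dot_eq0; rewrite -sqr_enorm u0 expr0n. Qed.

Lemma enormZ n k (u : 'cV[R]_n) : enorm (k *: u) = `|k| * enorm u.
Proof.
by rewrite /enorm dotZl dotZr mulrA -expr2 sqrtrM ?sqr_ge0 // sqrtr_sqr.
Qed.

Lemma enormN n (u : 'cV[R]_n) : enorm (- u) = enorm u.
Proof. by rewrite -scaleN1r enormZ normrN1 mul1r. Qed.

Lemma enorm_distC n (u v : 'cV[R]_n) : enorm (u - v) = enorm (v - u).
Proof. by rewrite -enormN opprB. Qed.

Lemma enorm_le n (u : 'cV[R]_n) k : 0 <= k -> dot u u <= k ^+ 2 -> enorm u <= k.
Proof. by move=> k0; rewrite -sqr_enorm ler_sqr ?nnegrE ?enorm_ge0. Qed.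

Lemma dot_le n (u v : 'cV[R]_n) : dot u v <= enorm u * enorm v.
Proof.
have [u0|] := eqVneq (enorm u) 0.
  by rewrite u0 (enorm_eq0 u0) dot0l mul0r.
have [v0|] := eqVneq (enorm v) 0.
  by rewrite v0 (enorm_eq0 v0) dot0r mulr0.
rewrite !neq_lt !ltNge !enorm_ge0 /= => v0 u0.
rewrite -!ltNge in u0 v0.
have := dot_ge0 (enorm v *: u - enorm u *: v).
rewrite !dotE (dotC v u) -!sqr_enorm => h.
rewrite -(ler_pM2l (mulr_gt0 u0 v0)); lra.
Qed.

Lemma dot_geN n (u v : 'cV[R]_n) : - (enorm u * enorm v) <= dot u v.
Proof. by rewrite lerNl -dotNl -(enormN u) dot_le. Qed.

Lemma enormD n (u v : 'cV[R]_n) : enorm (u + v) <= enorm u + enorm v.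
Proof.
apply: enorm_le; first by rewrite addr_ge0 ?enorm_ge0.
rewrite !dotE (dotC v u) -!sqr_enorm; have := dot_le u v; lra.
Qed.

Lemma enormB n (u v : 'cV[R]_n) : enorm (u - v) <= enorm u + enorm v.
Proof. by rewrite -(enormN v) enormD. Qed.

Lemma enorm_triangle n (v u w : 'cV[R]_n) :
  enorm (u - w) <= enorm (u - v) + enorm (v - w).
Proof. by have := enormD (u - v) (v - w); rewrite addrA subrK. Qed.

Lemma normr_coord_le n (u : 'cV[R]_n) i : `|u i 0| <= enorm u.
Proof.
rewrite -(ler_sqr (normr_ge0 _) (enorm_ge0 _)) sqr_enorm real_normK ?num_real // /dot.
rewrite (bigD1 i) //= -expr2 lerDl; apply: sumr_ge0 => j _.
by rewrite -expr2 sqr_ge0.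
Qed.

End Euclid.

(** * Compactness and existence of minimisers *)

Section Topology.
Context {R : realType}.

Lemma continuous_sumr (T : topologicalType) n (F : 'I_n -> T -> R) :
  (forall i, continuous (F i)) -> continuous (fun u => \sum_i F i u).
Proof.
move=> Fc; apply: continuous_big => [z|i _]; last exact: Fc.
by apply: continuousD; [exact: cvg_fst|exact: cvg_snd].
Qed.

Lemma continuous_mulmx_coord m n (A : 'M[R]_(m, n)) (i : 'I_m) :
  continuous (fun u : 'cV[R]_n => (A *m u) i 0).
Proof.
rewrite [X in continuous X](_ : _ =
    fun u : 'cV[R]_n => \sum_j A i j * u j 0); last first.
  by apply/funext => u; rewrite mxE.
apply: continuous_sumr => j.
move=> u; apply: continuousM; first exact: cst_continuous.
exact: coord_continuous.
Qed.

Lemma continuous_dot (T : topologicalType) n (F F' : T -> 'cV[R]_n) :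
  (forall i, continuous (fun u => F u i 0)) ->
  (forall i, continuous (fun u => F' u i 0)) ->
  continuous (fun u => dot (F u) (F' u)).
Proof.
move=> Fc Fc'; apply: continuous_sumr => i.
by move=> u; apply: continuousM; [exact: Fc|exact: Fc'].
Qed.

Lemma closed_sublevel (T : topologicalType) (g : T -> R) (a : R) :
  continuous g -> closed [set u | g u <= a].
Proof.
by move=> /continuous_closedP gc; exact: (gc [set r | r <= a] (@closed_le _ a)).
Qed.

Lemma closed_polyhedron l n (G : 'M[R]_(l, n)) (h : 'cV[R]_l) :
  closed (polyhedron G h).
Proof.
rewrite (_ : polyhedron G h =
    \bigcap_(i in setT) [set u | (G *m u) i 0 <= h i 0]); last first.
  by apply/seteqP; split => [u Pu i _ //=|u Pu i]; exact: Pu.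
apply: closed_bigI => i _; apply: closed_sublevel.
exact: continuous_mulmx_coord.
Qed.

Lemma continuous_coordB n (a : 'cV[R]_n) i :
  continuous (fun u : 'cV[R]_n => (u - a) i 0).
Proof.
rewrite [X in continuous X](_ : _ = fun u : 'cV[R]_n => u i 0 - a i 0); last first.
  by apply/funext => u; rewrite !mxE.
move=> u; apply: continuousB; [exact: coord_continuous|exact: cst_continuous].
Qed.

Lemma near_enorm n (a : 'cV[R]_n) (e : R) : 0 < e ->
  \forall u \near a, enorm (u - a) < e.
Proof.
move=> e0.
have : continuous (fun u : 'cV[R]_n => dot (u - a) (u - a)).
  by apply: continuous_dot => i; exact: continuous_coordB.
move=> /(_ a) /cvgr_lt /(_ (e ^+ 2)).
rewrite subrr dot0l exprn_gt0 // => /(_ isT); apply: filterS => u.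
by rewrite -sqr_enorm ltr_sqr ?nnegrE ?enorm_ge0 // ltW.
Qed.

Lemma closed_bounded_compact n (S : set 'cV[R]_n) (B : R) :
  closed S -> (forall u, S u -> forall i, `|u i 0| <= B) -> compact S.
Proof.
move=> clS bS; pose T := [set v : 'rV[R]_n | S v^T].
have trc : continuous (fun v : 'rV[R]_n => v^T).
  move=> v s /= /(nbhs_ballP v^T) [e e0 es].
  apply/nbhs_ballP; exists e => //= w [_ vw]; apply: es; split => // i j.
  by rewrite !mxE; exact: vw.
have -> : S = (fun v : 'rV[R]_n => v^T) @` T.
  apply/seteqP; split => [u Su|_ [v Tv <-] //].
  by exists u^T; rewrite /T /= ?trmxK.
apply: continuous_compact; first exact: continuous_subspaceT.
apply: bounded_closed_compact; last first.
  by move/continuous_closedP : trc; apply.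
exists `|B|; split => // M BM v Tv /=.
rewrite [leLHS]/Num.norm /= mx_normrE; apply/bigmax_leP; split => [|[i j] _] /=.
  exact/ltW/(le_lt_trans _ BM).
apply: le_trans (ltW BM); apply: le_trans (ler_norm B).
by have := bS _ Tv j; rewrite mxE ord1.
Qed.

(** The quadratic lower bound makes the sublevel set of [x0] compact. *)
Lemma exists_minimizer n (P : set 'cV[R]_n) (F : 'cV[R]_n -> R)
    (q x0 : 'cV[R]_n) (gamma : R) :
  closed P -> P x0 -> continuous F -> 0 < gamma ->
  (forall u, P u ->
     F x0 + dot q (u - x0) + gamma / 2 * dot (u - x0) (u - x0) <= F u) ->
  exists2 u, P u & forall v, P v -> F u <= F v.
Proof.
move=> clP Px0 Fc g0 FP; pose S := P `&` [set u | F u <= F x0].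
have clS : closed S by apply: closedI => //; exact: closed_sublevel.
have bS u : S u -> enorm (u - x0) <= 2 * enorm q / gamma.
  move=> [Pu /= Fu]; rewrite ler_pdivlMr //.
  have := FP _ Pu; rewrite -sqr_enorm; set e := enorm (u - x0) => h.
  have := dot_geN q (u - x0); rewrite -/e.
  have : 0 <= e by exact: enorm_ge0.
  rewrite le_eqVlt => /predU1P[<- _|e0 h']; first by rewrite mul0r mulr_ge0 // enorm_ge0.
  by rewrite -(ler_pM2l e0); nra.
have cS : compact S.
  apply: (@closed_bounded_compact _ _ (2 * enorm q / gamma + enorm x0)) => //.
  move=> u Su i; rewrite (_ : u i 0 = (u - x0) i 0 + x0 i 0); last first.
    by rewrite !mxE subrK.
  apply: (le_trans (ler_normD _ _)); apply: lerD; last exact: normr_coord_le.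
  by apply: le_trans (bS _ Su); exact: normr_coord_le.
have [|u] := @compact_EVT_min _ _ F _ _ cS (continuous_subspaceT Fc).
  by exists x0; split => //=.
rewrite inE => -[Pu Fu] umin; exists u => // v Pv.
have [Fv|Fv] := leP (F v) (F x0); first by apply: umin; rewrite inE.
exact: le_trans Fu (ltW Fv).
Qed.

End Topology.

(** * Gradients and Taylor estimates *)

Section Calculus.
Context {R : realType}.

(** The increment is an exact polynomial in [t], so the difference quotient is
    [a + t * b]. *)
Lemma is_derive_quadratic (V : normedModType R) (q : V -> R) (x v : V) (a b : R) :
  (forall t : R, q (x + t *: v) = q x + t * a + t ^+ 2 * b) -> is_derive x v q a.
Proof.
move=> qE.
have cvq : (fun t => t^-1 *: ((q \o shift x) (t *: v) - q x)) @ 0^' --> a.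
  apply: (@cvg_trans _ ((fun t : R => a + t * b) @ 0^')).
    apply: near_eq_cvg; near=> t.
    have t0 : t != 0 by near: t; exact: nbhs_dnbhs_neq.
    by rewrite /= [t *: v + x]addrC qE /GRing.scale /=; field.
  have : (fun t : R => a + t * b) @ (0 : R) --> a + 0 * b.
    by apply: cvgD; [exact: cvg_cst|apply: cvgMr_tmp; exact: cvg_id].
  by rewrite mul0r addr0 => /cvg_within_filter; exact.
by split; [apply/cvg_ex; exists a|exact: cvg_lim cvq].
Unshelve. all: by end_near. Qed.

Lemma derive_grad n (f : 'cV[R]_n -> R) x v :
  differentiable f x -> 'D_v f x = dot (grad f x) v.
Proof.
move=> df; rewrite deriveE //.
rewrite [X in 'd f x X](_ : _ = \sum_i v i 0 *: delta_mx i 0); last first.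
  rewrite {1}(matrix_sum_delta v); apply: eq_bigr => i _.
  by rewrite big_ord_recl big_ord0 addr0; congr (_ *: delta_mx _ _); rewrite ord1.
rewrite linear_sum; apply: eq_bigr => i _.
by rewrite linearZ /= mxE deriveE // [RHS]mulrC.
Qed.

Lemma is_derive_line n (f : 'cV[R]_n -> R) x v (t : R) :
  differentiable f (x + t *: v) ->
  is_derive t 1 (fun s : R => f (x + s *: v)) (dot (grad f (x + t *: v)) v).
Proof.
move=> df.
have E : (fun h : R =>
      h^-1 *: (((fun s : R => f (x + s *: v)) \o shift t) (h *: (1 : R))
               - f (x + t *: v)))
       = fun h => h^-1 *: ((f \o shift (x + t *: v)) (h *: v) - f (x + t *: v)).
  apply/funext => h /=; congr (_ *: (f _ - _)).
  by rewrite scaler1 scalerDl addrCA.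
split; first by rewrite /derivable E; exact: diff_derivable.
by rewrite /derive E -derive_grad.
Qed.

(** Only the growth of [dphi] from above is bounded, so that the lemma serves
    both [phi] and [- phi]. *)
Lemma le_taylor1 (phi dphi : R -> R) (M : R) :
  (forall t : R, is_derive t 1 phi (dphi t)) ->
  (forall t, 0 <= t -> t <= 1 -> dphi t - dphi 0 <= t * M) ->
  phi 1 - phi 0 - dphi 0 <= M / 2.
Proof.
move=> dphiP dphi_le.
pose psi t := phi t - (t * dphi 0 + t ^+ 2 * (M / 2)).
have psid (t : R) : is_derive t 1 psi (dphi t - (dphi 0 + t * M)).
  apply: is_deriveB; apply: (@is_derive_quadratic _ _ _ _ _ (M / 2)) => s.
  by rewrite /GRing.scale /=; field.
have psic : {within `[0, 1], continuous psi}.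
  apply: derivable_within_continuous => t _.
  exact: (@ex_derive _ _ _ _ _ _ _ (psid t)).
have [c /itvP c01] := MVT_segment ler01 (fun t _ => psid t) psic.
have := dphi_le c; rewrite !c01 => /(_ isT isT).
rewrite /psi subr0 mulr1 mul0r expr0n mul0r addr0 subr0 expr1n !mul1r.
by lra.
Qed.

Lemma polyhedron_segment l n (G : 'M[R]_(l, n)) (h : 'cV[R]_l) x v (t : R) :
  polyhedron G h x -> polyhedron G h v -> 0 <= t -> t <= 1 ->
  polyhedron G h (x + t *: (v - x)).
Proof.
move=> Px Pv t0 t1 i; have := Px i; have := Pv i.
rewrite mulmxDr -scalemxAr mulmxBr !mxE.
by set a := \sum_j _; set b := \sum_j _ => ah bh; nra.
Qed.

Section LipschitzGradient.
Context n (P : set 'cV[R]_n) (f : 'cV[R]_n -> R) (L : R).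
Hypothesis Pconv : forall x v (t : R), P x -> P v -> 0 <= t -> t <= 1 ->
  P (x + t *: (v - x)).
Hypothesis df : forall x, differentiable f x.
Hypothesis gradL : forall x v, P x -> P v ->
  enorm (grad f x - grad f v) <= L * enorm (x - v).

Lemma lipschitz_gradient_taylor x v : P x -> P v ->
  `|f v - f x - dot (grad f x) (v - x)| <= L / 2 * dot (v - x) (v - x).
Proof.
move=> Px Pv; set d := v - x.
pose phi t : R := f (x + t *: d); pose dphi t := dot (grad f (x + t *: d)) d.
have dphiP (t : R) : is_derive t 1 phi (dphi t) by exact: is_derive_line.
have x1 : x + 1 *: d = v by rewrite scale1r addrC subrK.
have x0 : x + 0 *: d = x by rewrite scale0r addr0.
have dphi_lip (t : R) : 0 <= t -> t <= 1 ->
    enorm (grad f (x + t *: d) - grad f x) * enorm d <= t * (L * dot d d).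
  move=> t0 t1; rewrite -sqr_enorm mulrA expr2 mulrA ler_wpM2r ?enorm_ge0 //.
  apply: (le_trans (gradL (Pconv Px Pv t0 t1) Px)).
  by rewrite addrC addKr enormZ ger0_norm // mulrCA mulrA.
have up := @le_taylor1 phi dphi (L * dot d d) dphiP.
have dn := @le_taylor1 (fun t => - phi t) (fun t => - dphi t) (L * dot d d).
rewrite /phi /dphi x0 x1 in up dn.
rewrite ler_norml; apply/andP; split.
  rewrite -(lerN2 (_ - _)) opprK; apply: le_trans (_ : L * dot d d / 2 <= _); last by lra.
  rewrite !opprB; apply: le_trans (dn _ _); first by lra.
  move=> t t0 t1; apply: le_trans (dphi_lip t t0 t1).
  by rewrite opprK addrC -dotNl -dotDl enorm_distC dot_le.
apply: le_trans (up _) _; last by lra.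
move=> t t0 t1; apply: le_trans (dphi_lip t t0 t1).
by rewrite -dotNl -dotDl dot_le.
Qed.

End LipschitzGradient.

Lemma grad_prox_aug_lagrangian m n (A : 'M[R]_(m, n)) b (f : 'cV[R]_n -> R)
    (rho p : R) (x z : 'cV[R]_n) y :
  differentiable f x ->
  grad (fun u => prox_aug_lagrangian A b f rho p u z y) x =
    grad f x + (A^T *m y + rho *: (A^T *m (A *m x - b)) + p *: (x - z)).
Proof.
move=> dfx; apply/colP => i; rewrite !mxE.
pose q u := dot y (A *m u - b) + rho / 2 * enorm (A *m u - b) ^+ 2
            + p / 2 * enorm (u - z) ^+ 2.
rewrite (_ : (fun u => _) = f \+ q); last first.
  by apply/funext => u; rewrite /prox_aug_lagrangian /aug_lagrangian /q /=; ring.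
pose a := A^T *m y + rho *: (A^T *m (A *m x - b)) + p *: (x - z).
pose e : 'cV[R]_n := delta_mx i 0.
have qd : is_derive x e q (dot a e).
  apply: (@is_derive_quadratic _ _ _ _ _
    (rho / 2 * dot (A *m e) (A *m e) + p / 2 * dot e e)) => t.
  rewrite /q !sqr_enorm mulmxDr -scalemxAr.
  rewrite (_ : A *m x + t *: (A *m e) - b = (A *m x - b) + t *: (A *m e)); last first.
    by rewrite addrAC.
  rewrite (_ : x + t *: e - z = (x - z) + t *: e); last by rewrite addrAC.
  rewrite /a; move: (A *m x - b) (x - z) => r w.
  rewrite !dotE -!dot_mulmxr (dotC (A *m e) r) (dotC e w).
  by field.
rewrite deriveD; [|exact: diff_derivable|exact: (@ex_derive _ _ _ _ _ _ _ qd)].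
congr (_ + _).
by rewrite (@derive_val _ _ _ _ _ _ _ qd) dotC dot_deltal !mxE.
Qed.

End Calculus.

(** * The largest singular value bounds the operator norm *)

Section SigmaMax.
Context {R : realType}.

Lemma exists_max_rayleigh m n (A : 'M[R]_(m, n)) (u : 'cV[R]_n) : u != 0 ->
  exists2 v : 'cV[R]_n, dot v v = 1 &
    forall w, dot (A *m w) (A *m w) <= dot (A *m v) (A *m v) * dot w w.
Proof.
move=> u0; pose S := [set v : 'cV[R]_n | dot v v = 1].
have unitize w : w != 0 -> S ((enorm w)^-1 *: w).
  move=> w0; rewrite /S /= dotZl dotZr mulrA -sqr_enorm -expr2 exprVn mulVf //.
  by rewrite expf_neq0 //; apply: contra_neq w0; exact: enorm_eq0.
have ddc : continuous (fun v : 'cV[R]_n => dot v v).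
  by apply: continuous_dot => i; exact: coord_continuous.
have clS : closed S.
  by move/continuous_closedP : ddc => /(_ [set 1] (@closed_eq _ 1)).
have cS : compact S.
  apply: (@closed_bounded_compact _ _ _ 1) => // v vS i.
  by apply: le_trans (normr_coord_le _ _) _; rewrite /enorm vS sqrtr1.
have Ac : continuous (fun v : 'cV[R]_n => dot (A *m v) (A *m v)).
  by apply: continuous_dot => i; exact: continuous_mulmx_coord.
have [|v] := @compact_EVT_max _ _ _ S _ cS (continuous_subspaceT Ac).
  by exists ((enorm u)^-1 *: u); exact: unitize.
rewrite inE => vS vmax; exists v => // w.
have [->|w0] := eqVneq w 0; first by rewrite mulmx0 !dot0l mulr0.
have := vmax _ (mem_set (unitize _ w0)).
rewrite -scalemxAr dotZl dotZr mulrA -expr2 exprVn sqr_enorm mulrC.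
rewrite ler_pdivrMr // lt_neqAle dot_ge0 andbT eq_sym.
by apply: contra_neq w0; exact: dot_eq0.
Qed.

Lemma sigma_max_ge0 m n (A : 'M[R]_(m, n)) : 0 <= sigma_max A.
Proof.
rewrite /sigma_max.
have [hs|/sup_out -> //] := pselect (has_sup (singular_values A)).
have [s sA] := hs.1; apply: le_trans (ub_le_sup hs.2 sA).
by case: sA => a _ <-; exact: sqrtr_ge0.
Qed.

(** A unit vector that maximises [|A v|] is an eigenvector of [A^T *m A], so the
    operator norm of [A] is itself one of the singular values. *)
Lemma enorm_mulmx_le m n (A : 'M[R]_(m, n)) u :
  enorm (A *m u) <= sigma_max A * enorm u.
Proof.
have [->|u0] := eqVneq u 0; first by rewrite mulmx0 !enorm0 mulr0.
have [v v1 vmax] := exists_max_rayleigh A u0.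
set a := dot (A *m v) (A *m v) in vmax.
have a0 : 0 <= a by exact: dot_ge0.
suff sa : Num.sqrt a <= sigma_max A.
  apply: enorm_le; first by rewrite mulr_ge0 ?sigma_max_ge0 ?enorm_ge0.
  apply: le_trans (vmax u) _; rewrite exprMn sqr_enorm ler_wpM2r ?dot_ge0 //.
  by rewrite -(sqr_sqrtr a0) ler_sqr // ?nnegrE ?sqrtr_ge0 ?sigma_max_ge0.
apply: ub_le_sup.
  exists (Num.sqrt a) => _ [c /eigenvalueP[w wc w0] <-]; apply: ler_wsqrtr.
  have wT0 : w^T != 0 by rewrite -(inj_eq (can_inj (@trmxK _ _ _))) trmxK trmx0.
  rewrite -(ler_pM2r (_ : 0 < dot w^T w^T)); last first.
    rewrite lt_neqAle dot_ge0 andbT eq_sym.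
    by apply: contra_neq wT0; exact: dot_eq0.
  have E : A^T *m A *m w^T = c *: w^T.
    by have /(congr1 trmx) := wc; rewrite !trmx_mul trmxK linearZ.
  by apply: le_trans (vmax w^T); rewrite dot_mulmxl mulmxA E dotZr.
exists a => //; apply/eigenvalueP; exists v^T; last first.
  apply/eqP => /(congr1 trmx); rewrite trmxK trmx0 => v0.
  by move: v1 (oner_neq0 R); rewrite v0 dot0l => <-; rewrite eqxx.
suff E : A^T *m (A *m v) = a *: v.
  by have /(congr1 trmx) := E; rewrite !trmx_mul trmxK linearZ /= => <-; rewrite mulmxA.
apply/eqP; rewrite -subr_eq0; apply/eqP/dot_eq0.
move De : (_ - _) => e.
(* The quadratic form [a |.|^2 - |A .|^2] is nonnegative and vanishes at [v],
   hence so does its derivative there. *)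
have q t : 2 * t * dot e e <= t ^+ 2 * (a * dot e e).
  have := vmax (v + t *: e).
  rewrite mulmxDr -scalemxAr !dotE v1 -/a (dotC (A *m e)) (dotC e v).
  have -> : dot (A *m v) (A *m e) = dot e e + a * dot v e.
    by rewrite dot_mulmxr -dotZl -dotDl -De subrK.
  have := dot_ge0 (A *m e); nra.
have [ee0|ee0] := eqVneq (dot e e) 0; first by [].
have eep : 0 < dot e e by rewrite lt_neqAle eq_sym ee0 dot_ge0.
have := q (1 / (a + 1)).
have a1 : 0 < a + 1 by rewrite ltr_wpDl.
rewrite -subr_ge0 (_ : _ - _ = - (dot e e) * ((a + 2) / (a + 1) ^+ 2)).
  by rewrite mulNr oppr_ge0 leNgt mulr_gt0 // divr_gt0 ?exprn_gt0 // ltr_wpDl.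
by field; rewrite gt_eqF.
Qed.

End SigmaMax.

(** * Farkas' lemma and Lagrange multipliers *)

Section Multipliers.
Context {R : realType}.

(** Farkas' lemma by induction on the number of inequalities, after Bartl. If
    the first one cannot be dropped, some [x1] satisfies the others and violates
    the conclusion. Subtracting a multiple of it moves any [d] to the hyperplane
    where the first inequality is tight, which leaves one inequality less. *)
Lemma farkas_family n k (a : 'I_k -> 'cV[R]_n) (q : 'cV[R]_n) :
  (forall d, (forall i, dot (a i) d <= 0) -> dot q d <= 0) ->
  exists2 c : 'I_k -> R, forall i, 0 <= c i & q = \sum_i c i *: a i.
Proof.
elim: k => [|k IH] in a q * => aq.
  exists (fun=> 0) => //; rewrite big_ord0; apply: dot_eq0; apply/eqP.
  by rewrite eq_le dot_ge0 andbT; apply: aq => -[].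
pose b i := a (lift ord0 i).
have [bq|] := pselect (forall d, (forall i, dot (b i) d <= 0) -> dot q d <= 0).
  have [c c0 qE] := IH _ _ bq.
  exists (fun i => if unlift ord0 i is Some j then c j else 0).
    by move=> i; case: unliftP.
  rewrite big_ord_recl unlift_none scale0r add0r qE.
  by apply: eq_bigr => i _; rewrite liftK.
move=> /existsNP[x1 /not_implyP[bx1 /negP]]; rewrite -ltNge => qx1.
have ax1 : 0 < dot (a ord0) x1.
  rewrite ltNge; apply/negP => ax1; move: qx1; rewrite ltNge aq // => i.
  by case: (unliftP ord0 i) => [j ->|-> //]; exact: bx1.
pose x0 := (dot (a ord0) x1)^-1 *: x1.
have ax0 : dot (a ord0) x0 = 1 by rewrite dotZr mulVf // gt_eqF.
have bx0 i : dot (b i) x0 <= 0 by rewrite dotZr pmulr_rle0 ?invr_gt0.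
have qx0 : 0 < dot q x0 by rewrite dotZr mulr_gt0 ?invr_gt0.
have [d|c c0 qE] := IH (fun i => b i - dot (b i) x0 *: a ord0)
    (q - dot q x0 *: a ord0).
  have swap u : dot (u - dot u x0 *: a ord0) d = dot u (d - dot (a ord0) d *: x0).
    by rewrite !dotE [X in _ - X]mulrC.
  move=> bd; rewrite swap; apply: aq => i.
  case: (unliftP ord0 i) => [j ->|->]; first by rewrite -swap; exact: bd.
  by rewrite -swap ax0 scale1r subrr dot0l.
exists (fun i => if unlift ord0 i is Some j then c j
                 else dot q x0 - \sum_j c j * dot (b j) x0).
  move=> i; case: unliftP => [j _ //|_].
  rewrite subr_ge0 (le_trans _ (ltW qx0)) // -oppr_ge0 -sumrN.
  by apply: sumr_ge0 => j _; rewrite -mulrN mulr_ge0 // oppr_ge0.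
rewrite big_ord_recl unlift_none.
rewrite -[LHS](subrK (dot q x0 *: a ord0)) qE scalerBl addrC -addrA.
congr (_ + _); rewrite scaler_suml -sumrN -big_split /=.
apply: eq_bigr => i _; rewrite liftK scalerBr scalerA addrC.
by [].
Qed.

Lemma mulmx_trE l n (G : 'M[R]_(l, n)) (mu : 'cV[R]_l) :
  G^T *m mu = \sum_i mu i 0 *: (row i G)^T.
Proof.
apply/colP => j; rewrite mxE summxE; apply: eq_bigr => i _.
by rewrite !mxE mulrC.
Qed.

Lemma dot_row l n (G : 'M[R]_(l, n)) d i : dot (row i G)^T d = (G *m d) i 0.
Proof. by rewrite !mxE; apply: eq_bigr => j _; rewrite !mxE. Qed.

(** The step is the least of the finitely many lengths at which an inactive
    constraint becomes tight. *)
Lemma polyhedron_feasible_direction l n (G : 'M[R]_(l, n)) (h : 'cV[R]_l) x d :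
  polyhedron G h x ->
  (forall i, (G *m x) i 0 = h i 0 -> (G *m d) i 0 <= 0) ->
  exists2 t : R, 0 < t & polyhedron G h (x + t *: d).
Proof.
move=> Px Gd.
pose s i := if (G *m d) i 0 <= 0 then 1 else (h i 0 - (G *m x) i 0) / (G *m d) i 0.
have s0 i : 0 < s i.
  rewrite /s; have [Gdi|Gdi] := leP ((G *m d) i 0) 0; first exact: ltr01.
  rewrite divr_gt0 // subr_gt0 lt_neqAle Px andbT.
  by apply/eqP => /Gd; rewrite leNgt Gdi.
pose t := \big[Num.min/1]_i s i.
have t0 : 0 < t by rewrite /t; elim/big_ind: _ => // a b a0 b0; rewrite lt_min a0.
exists t => // i; rewrite -dot_row dotDr dotZr !dot_row.
have ts : t <= s i by exact: bigmin_le_cond.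
have [Gdi|Gdi] := leP ((G *m d) i 0) 0.
  have := Px i; have : t * (G *m d) i 0 <= 0 by rewrite pmulr_rle0.
  lra.
by move: ts; rewrite /s (lt_geF Gdi) ler_pdivlMr //; lra.
Qed.

(** Farkas' lemma for the active rows. The inactive rows are replaced by zero,
    which keeps the index type and gives complementary slackness. *)
Lemma polyhedron_multipliers l n (G : 'M[R]_(l, n)) (h : 'cV[R]_l) x q :
  polyhedron G h x -> (forall v, polyhedron G h v -> 0 <= dot q (v - x)) ->
  exists mu : 'cV[R]_l,
    [/\ q + G^T *m mu = 0, forall i, 0 <= mu i 0
      & forall i, mu i 0 * (G *m x - h) i 0 = 0].
Proof.
move=> Px qP.
pose act i := (G *m x) i 0 == h i 0.
have [d ad|c c0 qE] := @farkas_family _ _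
    (fun i => (act i)%:R *: (row i G)^T) (- q).
  have [i|t t0 Pt] := @polyhedron_feasible_direction _ _ G h x d Px.
    by move=> Gi; have := ad i; rewrite /act Gi eqxx scale1r dot_row.
  have := qP _ Pt; rewrite addrC addKr dotZr pmulr_rge0 //.
  by rewrite dotNl oppr_le0.
exists (\col_i (c i * (act i)%:R)); split => [|i|i].
- apply/eqP; rewrite addr_eq0 -(inj_eq oppr_inj) opprK qE mulmx_trE; apply/eqP.
  by apply: eq_bigr => i _; rewrite mxE scalerA.
- by rewrite mxE mulr_ge0.
- rewrite mxE /act; case: eqP => [Gi|_]; last by rewrite mulr0 mul0r.
  by rewrite mxE Gi mxE subrr mulr0.
Qed.

(** Each equation is a pair of opposite inequalities, and [y] is the difference
    of their multipliers. *)
Lemma feasible_multipliers m l n (A : 'M[R]_(m, n)) b (G : 'M[R]_(l, n))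
    (h : 'cV[R]_l) x q :
  feasible A b G h x -> (forall v, feasible A b G h v -> 0 <= dot q (v - x)) ->
  exists (y : 'cV[R]_m) (mu : 'cV[R]_l),
    [/\ q + A^T *m y + G^T *m mu = 0, forall i, 0 <= mu i 0
      & forall i, mu i 0 * (G *m x - h) i 0 = 0].
Proof.
move=> Fx qF.
pose GA := col_mx (col_mx A (- A)) G; pose hb := col_mx (col_mx b (- b)) h.
have FE v : feasible A b G h v <-> polyhedron GA hb v.
  rewrite /GA /hb /polyhedron /= !mul_col_mx mulNmx; split => [[/= <- Pv] i|Pv].
    case: (split_ordP i) => j ->; last by rewrite !col_mxEd; exact: Pv.
    by rewrite !col_mxEu.
  split=> [/=|i]; last by have := Pv (rshift _ i); rewrite !col_mxEd.
  apply/colP => i; apply/eqP; rewrite eq_le; apply/andP; split.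
    by have := Pv (lshift _ (lshift _ i)); rewrite !col_mxEu.
  have := Pv (lshift _ (rshift _ i)); rewrite !col_mxEu !col_mxEd.
  by rewrite !mxE lerN2.
have [|v /FE/qF //|mu [qmu mu0 muc]] := @polyhedron_multipliers _ _ GA hb x q.
  exact/FE.
exists (usubmx (usubmx mu) - dsubmx (usubmx mu)), (dsubmx mu); split.
- move: qmu; rewrite /GA -{1}(vsubmxK mu) -{1}(vsubmxK (usubmx mu)).
  rewrite !tr_col_mx !mul_row_col linearN /= mulNmx -mulmxBr !addrA => <-.
  by [].
- by move=> i; rewrite mxE.
- move=> i; have := muc (rshift _ i).
  by rewrite mul_col_mx opp_col_mx add_col_mx col_mxEd [in dsubmx _ _ _]mxE.
Qed.

End Multipliers.

(** * Strongly convex minimisation under perturbed equality constraints *)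

Section StronglySmooth.
Context {R : realType}.

(** What the proof uses of [gamma]-strong convexity and of an [L]-Lipschitz
    gradient [DF]. The estimates are confined to [P] because the gradient of the
    objective is Lipschitz there only. *)
Definition strongly_smooth {n} (P : set 'cV[R]_n) (F : 'cV[R]_n -> R)
    (DF : 'cV[R]_n -> 'cV[R]_n) (gamma L : R) : Prop :=
  [/\ continuous F,
      forall x v, P x -> P v ->
        gamma / 2 * dot (v - x) (v - x) <= F v - F x - dot (DF x) (v - x),
      forall x v, P x -> P v ->
        F v - F x - dot (DF x) (v - x) <= L / 2 * dot (v - x) (v - x)
    & forall x v, P x -> P v -> enorm (DF x - DF v) <= L * enorm (x - v)].

(** First-order optimality over [S], which characterises the minimiser of a
    strongly convex function over a convex set. *)
Definition solves_vi {n} (S : set 'cV[R]_n) (DF : 'cV[R]_n -> 'cV[R]_n) x :=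
  S x /\ forall v, S v -> 0 <= dot (DF x) (v - x).

Definition segment_closed {n} (S : set 'cV[R]_n) := forall x v (t : R),
  S x -> S v -> 0 <= t -> t <= 1 -> S (x + t *: (v - x)).

Lemma ge0_first_order (a c : R) :
  (forall t, 0 < t -> t <= 1 -> 0 <= t * a + t ^+ 2 * c) -> 0 <= a.
Proof.
move=> H; rewrite leNgt; apply/negP => a0.
have d0 : 0 < `|c| - a by rewrite subr_gt0 (lt_le_trans a0).
have t0 : 0 < - a / (`|c| - a) by rewrite divr_gt0 // oppr_gt0.
have t1 : - a / (`|c| - a) <= 1 by rewrite ler_pdivrMr // mul1r lerDr.
have := H _ t0 t1; rewrite expr2 -mulrA -mulrDr pmulr_rge0 //.
rewrite leNgt => /negP; apply.
apply: le_lt_trans (_ : a + - a / (`|c| - a) * `|c| < 0).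
  by rewrite lerD2l ler_wpM2l ?ler_norm // ltW.
rewrite (_ : _ + _ = - a ^+ 2 / (`|c| - a)); last by field; rewrite gt_eqF.
by rewrite mulNr oppr_lt0 divr_gt0 // exprn_even_gt0 //= lt_eqF.
Qed.

Section Minimizers.
Context n (P : set 'cV[R]_n) (F : 'cV[R]_n -> R) (DF : 'cV[R]_n -> 'cV[R]_n).
Context (gamma L : R).
Hypothesis gamma_gt0 : 0 < gamma.
Hypothesis FP : strongly_smooth P F DF gamma L.

Lemma strongly_monotone x v : P x -> P v ->
  gamma * dot (x - v) (x - v) <= dot (DF x - DF v) (x - v).
Proof.
move=> Px Pv; have [_ H _ _] := FP.
have := H _ _ Px Pv; have := H _ _ Pv Px.
rewrite -(opprB x v) !dotE; lra.
Qed.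

Lemma solves_vi_min (S : set 'cV[R]_n) x v : S `<=` P -> solves_vi S DF x -> S v ->
  F x + gamma / 2 * dot (v - x) (v - x) <= F v.
Proof.
move=> SP [Sx xvi] Sv; have [_ H _ _] := FP.
by have := H _ _ (SP _ Sx) (SP _ Sv); have := xvi _ Sv; lra.
Qed.

Lemma solves_vi_unique (S : set 'cV[R]_n) x v : S `<=` P ->
  solves_vi S DF x -> solves_vi S DF v -> x = v.
Proof.
move=> SP [Sx xvi] [Sv vvi]; apply/eqP; rewrite -subr_eq0; apply/eqP/dot_eq0.
move Dd : (dot _ _) => d.
have := strongly_monotone (SP _ Sx) (SP _ Sv).
have := xvi _ Sv; have := vvi _ Sx; rewrite Dd -(opprB x v) dotNr dotDl dotNl.
move=> h1 h2 h3; apply/eqP; rewrite eq_le -{2}Dd dot_ge0 andbT.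
by rewrite -(ler_pM2l gamma_gt0) mulr0; lra.
Qed.

Lemma exists_solves_vi (S : set 'cV[R]_n) : closed S -> segment_closed S ->
  S `<=` P -> S !=set0 -> exists x, solves_vi S DF x.
Proof.
move=> clS Sconv SP [x0 Sx0]; have [Fc Flo Fup _] := FP.
have [u Su umin] := exists_minimizer (q := DF x0) clS Sx0 Fc gamma_gt0
   (fun u Su => ltac:(have := Flo _ _ (SP _ Sx0) (SP _ Su); lra)).
exists u; split => // v Sv.
apply: (@ge0_first_order _ (L / 2 * dot (v - u) (v - u))) => t t0 t1.
have St := Sconv _ _ t Su Sv (ltW t0) t1.
have := Fup _ _ (SP _ Su) (SP _ St); have := umin _ St.
rewrite [u + _]addrC addrK !dotZr dotZl; lra.
Qed.

End Minimizers.
End StronglySmooth.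

Section ErrorBound.
Context {R : realType}.

(** A sequence that takes small steps, and moves at speed at most [C] between
    any two times of the same colour, moves at speed [C] up to one small step
    per colour: go straight to the last visit of the present colour, which never
    recurs after that, and take one step. *)
Lemma coloured_chain (T : finType) n (u : nat -> 'cV[R]_n) (col : nat -> T)
    (C eta : R) (N : nat) : 0 <= eta ->
  (forall i j, (i <= j <= N)%N -> col i = col j ->
     enorm (u j - u i) <= C * (j%:R - i%:R)) ->
  (forall i, (i < N)%N -> enorm (u i.+1 - u i) <= eta) ->
  0 <= C ->
  enorm (u N - u 0%N) <= C * N%:R + #|T|%:R * eta.
Proof.
move=> eta0 same step C0.
suff H k (S : {set T}) a : #|S| = k -> (a <= N)%N ->
    (forall i, (a <= i <= N)%N -> col i \in S) ->
    enorm (u N - u a) <= C * (N%:R - a%:R) + k%:R * eta.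
  have := H _ _ 0%N (cardsT T) (leq0n N) (fun i _ => finset.in_setT _).
  by rewrite subr0.
elim: k => [|k IH] in S a *.
  move=> /cards0_eq -> aN /(_ a); rewrite aN leqnn => /(_ isT).
  by rewrite finset.inE.
move=> Sk aN colS.
pose p j := (a <= j <= N)%N && (col j == col a).
have pa : exists j, p j by exists a; rewrite /p leqnn aN eqxx.
have pN j : p j -> (j <= N)%N by move=> /andP[/andP[]].
case: (ex_maxnP pa pN) => j /andP[/andP[aj jN] /eqP cj] jmax.
have uja : enorm (u j - u a) <= C * (j%:R - a%:R) by apply: same; rewrite ?aj.
move: jN; rewrite leq_eqVlt => /predU1P[jN|jN].
  by rewrite -jN (le_trans uja) // lerDl mulr_ge0.
have := IH (S :\ col a) j.+1; rewrite jN => /(_ _ isT).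
have -> : #|S :\ col a| = k.
  by have := cardsD1 (col a) S; rewrite Sk colS ?leqnn ?aN // add1n => -[->].
move=> /(_ erefl) IHj.
apply: (le_trans (enorm_triangle (u j.+1) _ _)).
apply: (le_trans (lerD (lexx _) (enorm_triangle (u j) _ _))).
have -> : C * (N%:R - a%:R) + k.+1%:R * eta =
    (C * (N%:R - j%:R) + k%:R * eta) + (eta + C * (j%:R - a%:R)).
  by rewrite -natr1; ring.
apply: lerD; last by apply: lerD => //; exact: step.
apply: le_trans (IHj _) _.
  move=> i /andP[ji iN]; rewrite !finset.inE colS ?iN ?(leq_trans aj (ltnW ji)) //.
  rewrite andbT; apply/eqP => ci; have := jmax i.
  by rewrite /p iN ci eqxx (leq_trans aj (ltnW ji)) => /(_ isT); rewrite leqNgt ji.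
by rewrite lerD2r ler_wpM2l // lerD2l lerN2 ler_nat.
Qed.

(** A vector [M^T *m w] of the row space is also [M^T *m w'] for some [w'] of
    comparable size, given by the pseudo-inverse; then pair [w'] with
    [M *m d]. *)
Lemma dot_row_space_le k n (M : 'M[R]_(k, n)) w d :
  dot (M^T *m w) d <=
    sigma_max (pinvmx M)^T * enorm (M^T *m w) * enorm (M *m d).
Proof.
move Ev : (M^T *m w) => v.
have vE : v = M^T *m ((pinvmx M)^T *m v).
  apply: trmx_inj; rewrite !trmx_mul !trmxK -Ev trmx_mul trmxK.
  by rewrite mulmxKpV // submxMl.
rewrite [in leLHS]vE -dot_mulmxr; apply: (le_trans (dot_le _ _)).
by rewrite ler_wpM2r ?enorm_ge0 // enorm_mulmx_le.
Qed.

(** The rows of [G] outside [I] are set to zero, so that all sets [I] give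
    matrices of one type. *)
Definition active_rows {m l n} (A : 'M[R]_(m, n)) (G : 'M[R]_(l, n))
    (I : {set 'I_l}) : 'M[R]_(m + l, n) :=
  col_mx A (diag_mx (\row_i (i \in I)%:R) *m G).

Definition perturbation_const {m l n} (A : 'M[R]_(m, n)) (G : 'M[R]_(l, n)) : R :=
  \sum_(I : {set 'I_l}) sigma_max (pinvmx (active_rows A G I))^T.

Lemma perturbation_const_ge0 m l n (A : 'M[R]_(m, n)) (G : 'M[R]_(l, n)) :
  0 <= perturbation_const A G.
Proof. by apply: sumr_ge0 => I _; exact: sigma_max_ge0. Qed.

Lemma sigma_max_le_perturbation m l n (A : 'M[R]_(m, n)) (G : 'M[R]_(l, n)) I :
  sigma_max (pinvmx (active_rows A G I))^T <= perturbation_const A G.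
Proof.
rewrite /perturbation_const (bigD1 I) //= lerDl.
by apply: sumr_ge0 => J _; exact: sigma_max_ge0.
Qed.

Section TwoKKTPoints.
Context m l n (A : 'M[R]_(m, n)) (G : 'M[R]_(l, n)) (h : 'cV[R]_l).
Context (F : 'cV[R]_n -> R) (DF : 'cV[R]_n -> 'cV[R]_n) (gamma L : R).
Hypothesis gamma_gt0 : 0 < gamma.
Hypothesis L_ge0 : 0 <= L.
Hypothesis FP : strongly_smooth (polyhedron G h) F DF gamma L.

Definition kkt_system (b : 'cV[R]_m) (x : 'cV[R]_n) (y : 'cV[R]_m)
    (mu : 'cV[R]_l) :=
  [/\ feasible A b G h x, DF x + A^T *m y + G^T *m mu = 0,
      forall i, 0 <= mu i 0 & forall i, mu i 0 * (G *m x - h) i 0 = 0].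

Context (b b' : 'cV[R]_m) (x x' : 'cV[R]_n) (y y' : 'cV[R]_m) (mu mu' : 'cV[R]_l).
Hypothesis kx : kkt_system b x y mu.
Hypothesis kx' : kkt_system b' x' y' mu'.

Lemma kkt_feasible : polyhedron G h x /\ polyhedron G h x'.
Proof. by case: kx => -[]; case: kx' => -[]. Qed.

Lemma kkt_gradB :
  DF x' - DF x = - (A^T *m (y' - y) + G^T *m (mu' - mu)).
Proof.
case: kx => _ /eqP + _ _; rewrite -addrA addr_eq0 => /eqP ->.
case: kx' => _ /eqP + _ _; rewrite -addrA addr_eq0 => /eqP ->.
by rewrite !mulmxBr !opprD !opprK addrACA.
Qed.

Lemma kkt_mulmxB : A *m (x' - x) = b' - b.
Proof. by case: kx => -[/= <- _] _ _ _; case: kx' => -[/= <- _] _ _ _; rewrite mulmxBr. Qed.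

(** Complementary slackness makes the inequality multipliers monotone. *)
Lemma kkt_monotone :
  gamma * dot (x' - x) (x' - x) <= - dot (y' - y) (b' - b).
Proof.
have [Px Px'] := kkt_feasible.
apply: (le_trans (strongly_monotone FP Px' Px)).
rewrite kkt_gradB dotNl (dotDl (A^T *m _)) -!dot_mulmxr kkt_mulmxB opprD gerDl oppr_le0.
rewrite (_ : G *m (x' - x) = (G *m x' - h) - (G *m x - h)); last first.
  by rewrite mulmxBr opprB addrA subrK.
apply: sumr_ge0 => i _.
case: kx => _ _ /(_ i) mu0 /(_ i); case: kx' => _ _ /(_ i) mu0' /(_ i).
have gx : (G *m x - h) i 0 <= 0 by rewrite mxE [(- h) i 0]mxE subr_le0.
have gx' : (G *m x' - h) i 0 <= 0 by rewrite mxE [(- h) i 0]mxE subr_le0.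
move: gx gx'; move: (G *m x - h) (G *m x' - h) => u u' ui ui' c' c.
rewrite !mxE; nra.
Qed.

(** If [I] is the support of both inequality multipliers, the gradients differ
    by a vector of the row space of [active_rows A G I], while this matrix maps
    [x' - x] to [b' - b] followed by zeros, the constraints of [I] being tight at
    both points. Strong monotonicity then cancels one factor [enorm (x' - x)]. *)
Lemma kkt_same_support (I : {set 'I_l}) :
  (forall i, (i \in I) = (mu i 0 != 0)) ->
  (forall i, (i \in I) = (mu' i 0 != 0)) ->
  gamma * enorm (x' - x) <= perturbation_const A G * L * enorm (b' - b).
Proof.
move=> Imu Imu'; have [Px Px'] := kkt_feasible.
pose M := active_rows A G I; pose w := - col_mx (y' - y) (mu' - mu).
have [->|xx] := eqVneq (enorm (x' - x)) 0.
  by rewrite mulr0 !mulr_ge0 ?enorm_ge0 ?perturbation_const_ge0.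
have xx0 : 0 < enorm (x' - x) by rewrite lt_neqAle eq_sym xx enorm_ge0.
have gE : DF x' - DF x = M^T *m w.
  rewrite kkt_gradB /M /active_rows tr_col_mx mulmxN mul_row_col.
  rewrite trmx_mul tr_diag_mx -mulmxA; congr (- (_ + _ *m _)).
  apply/colP => i; rewrite mul_diag_mx !mxE Imu.
  have := Imu i; rewrite Imu'; case: eqP => [->|_]; case: eqP => [->|_] //= _.
    by rewrite mul0r subrr.
  by rewrite mul1r.
have ME : M *m (x' - x) = col_mx (b' - b) 0.
  rewrite /M /active_rows mul_col_mx kkt_mulmxB -mulmxA; congr col_mx.
  apply/colP => i; rewrite mul_diag_mx mxE [RHS]mxE [(\row_ _ _) _ _]mxE.
  case: (boolP (i \in I)) => [iI|_]; last by rewrite mul0r.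
  rewrite mul1r -dot_row dotDr dotNr !dot_row.
  have active (u : 'cV[R]_n) (nu : 'cV[R]_l) : nu i 0 != 0 ->
      nu i 0 * (G *m u - h) i 0 = 0 -> (G *m u) i 0 = h i 0.
    move=> nu0 /eqP; rewrite mulf_eq0 (negPf nu0) /= mxE [(- h) i 0]mxE.
    by rewrite subr_eq0 => /eqP.
  case: kx => _ _ _ /(_ i) /active ->; last by rewrite -Imu.
  by case: kx' => _ _ _ /(_ i) /active ->; rewrite ?subrr // -Imu'.
have := strongly_monotone FP Px' Px.
rewrite gE => /le_trans /(_ (dot_row_space_le _ _ _)).
rewrite -sqr_enorm ME -gE.
have -> : enorm (col_mx (b' - b) (0 : 'cV[R]_l)) = enorm (b' - b).
  by rewrite /enorm dot_col_mx dot0l addr0.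
move=> H; rewrite -(ler_pM2r xx0).
have -> : gamma * enorm (x' - x) * enorm (x' - x) = gamma * enorm (x' - x) ^+ 2.
  by ring.
apply: le_trans H _; rewrite [leRHS]mulrAC ler_wpM2r ?enorm_ge0 // -mulrA.
apply: ler_pM; rewrite ?enorm_ge0 ?sigma_max_ge0 ?sigma_max_le_perturbation //.
by have [_ _ _ ->] := FP.
Qed.

End TwoKKTPoints.

Lemma closed_affine m n (A : 'M[R]_(m, n)) b : closed [set x : 'cV[R]_n | A *m x = b].
Proof.
rewrite (_ : [set x | _] =
    \bigcap_(i in setT) [set u : 'cV[R]_n | (A *m u) i 0 = b i 0]); last first.
  apply/seteqP; split => [u /= Au i _ /=|u Au /=]; first by rewrite Au.
  by apply/colP => i; exact: Au.
apply: closed_bigI => i _.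
have /continuous_closedP : continuous (fun u : 'cV[R]_n => (A *m u) i 0).
  exact: continuous_mulmx_coord.
by move=> /(_ [set b i 0] (@closed_eq _ _)).
Qed.

(** Along the segment from [b0] to [b1], take the minimisers with multipliers
    on a fine grid. [kkt_monotone] makes the steps uniformly small and
    [kkt_same_support] bounds the moves between points whose multipliers have
    the same support; [coloured_chain] combines the two. *)
Lemma perturbation_bound m l n (A : 'M[R]_(m, n)) (G : 'M[R]_(l, n))
    (h : 'cV[R]_l) (F : 'cV[R]_n -> R) (DF : 'cV[R]_n -> 'cV[R]_n)
    (gamma L : R) (b0 b1 : 'cV[R]_m) (x0 x1 : 'cV[R]_n) :
  0 < gamma -> 0 <= L -> strongly_smooth (polyhedron G h) F DF gamma L ->
  solves_vi (feasible A b0 G h) DF x0 -> solves_vi (feasible A b1 G h) DF x1 ->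
  gamma * enorm (x1 - x0) <= perturbation_const A G * L * enorm (b1 - b0).
Proof.
move=> g0 L0 FP x0P x1P.
pose bt (t : R) := b0 + t *: (b1 - b0).
have SP b : feasible A b G h `<=` polyhedron G h by move=> x [].
have ext (t : R) : exists k : 'cV[R]_n * 'cV[R]_m * 'cV[R]_l, 0 <= t <= 1 ->
    solves_vi (feasible A (bt t) G h) DF k.1.1 /\
    kkt_system A G h DF (bt t) k.1.1 k.1.2 k.2.
  have [/andP[t0 t1]|tN] := boolP (0 <= t <= 1); last by exists (0, 0, 0).
  have [x xP] : exists x, solves_vi (feasible A (bt t) G h) DF x.
    apply: (exists_solves_vi g0 FP) => //.
    - by apply: closedI; [exact: closed_affine|exact: closed_polyhedron].
    - move=> u v s [/= Au Pu] [/= Av Pv] s0 s1; split.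
        by rewrite /= mulmxDr -scalemxAr mulmxBr Au Av subrr scaler0 addr0.
      exact: polyhedron_segment.
    - exists (x0 + t *: (x1 - x0)); case: x0P x1P => -[/= A0 P0] _ [[/= A1 P1] _].
      split; last exact: polyhedron_segment.
      by rewrite /= mulmxDr -scalemxAr mulmxBr A0 A1.
  have [y [mu [e mu0 muc]]] := feasible_multipliers xP.1 xP.2.
  by exists (x, y, mu) => _; split => //; split => //; case: xP.
have [k kP] := choice ext.
pose X (t : R) := (k t).1.1; pose Y (t : R) := (k t).1.2; pose mu (t : R) := (k t).2.
pose s (t : R) := - dot (Y t) (b1 - b0).
have btB t t' : bt t' - bt t = (t' - t) *: (b1 - b0).
  by rewrite /bt opprD addrACA subrr add0r -scalerBl.
have mono t t' : 0 <= t <= 1 -> 0 <= t' <= 1 ->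
    gamma * dot (X t' - X t) (X t' - X t) <= (t' - t) * (s t' - s t).
  move=> /kP[_ kt] /kP[_ kt']; apply: le_trans (kkt_monotone FP kt kt') _.
  by rewrite btB dotZr dotDl dotNl /s; lra.
have smono t t' : 0 <= t -> t <= t' -> t' <= 1 -> s t <= s t'.
  move=> t0; rewrite le_eqVlt => /predU1P[-> //|tt'] t1.
  have /mono : 0 <= t <= 1 by rewrite t0 (le_trans (ltW tt')).
  move=> /(_ t'); rewrite t1 (le_trans t0 (ltW tt')) => /(_ isT).
  move=> /(le_trans (mulr_ge0 (ltW g0) (dot_ge0 _))).
  by rewrite pmulr_rge0 ?subr_gt0 // subr_ge0.
have X0 : X 0 = x0.
  have [|h0 _] := kP 0; first by rewrite lexx ler01.
  apply: (solves_vi_unique g0 FP (SP b0)) => //.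
  by move: h0; rewrite /bt scale0r addr0.
have X1 : X 1 = x1.
  have [|h0 _] := kP 1; first by rewrite lexx ler01.
  apply: (solves_vi_unique g0 FP (SP b1)) => //.
  by move: h0; rewrite /bt scale1r addrC subrK.
set C := perturbation_const A G * L * enorm (b1 - b0).
have C0 : 0 <= C by rewrite !mulr_ge0 ?enorm_ge0 ?perturbation_const_ge0.
rewrite mulrC -ler_pdivlMr //; apply/ler_addgt0Pr => e e0.
pose K : R := #|{set 'I_l}|%:R + 1.
have K0 : 0 < K by rewrite ltr_wpDl.
pose eta := e / K; have eta0 : 0 < eta by rewrite divr_gt0.
have sD : 0 <= s 1 - s 0 by rewrite subr_ge0 smono.
have [N N0 NP] : exists2 N : nat, (0 < N)%N &
    (s 1 - s 0) <= gamma * eta ^+ 2 * N%:R.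
  exists (Num.truncn ((gamma * eta ^+ 2)^-1 * (s 1 - s 0))).+1 => //.
  have ge0 : 0 < gamma * eta ^+ 2 by rewrite mulr_gt0 // exprn_gt0.
  by rewrite -ler_pdivrMl // ltW // truncnS_gt.
have Np : 0 < (N%:R : R) by rewrite ltr0n.
pose tau (i : nat) : R := i%:R / N%:R.
have tau01 i : (i <= N)%N -> 0 <= tau i <= 1.
  by move=> iN; rewrite /tau divr_ge0 //= ler_pdivrMr // mul1r ler_nat.
have tauB i j : tau j - tau i = (j%:R - i%:R) / N%:R by rewrite -mulrBl.
pose col i := finset (fun j => mu (tau i) j 0 != 0).
have := @coloured_chain _ _ (fun i => X (tau i)) col (C / gamma / N%:R) eta N
  (ltW eta0).
rewrite /tau mul0r divff ?gt_eqF // X0 X1 divfK ?gt_eqF //.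
have -> : e = K * eta by rewrite mulrC divfK // gt_eqF.
move=> H; apply: le_trans (H _ _ _) _.
- move=> i j /andP[ij jN] cij.
  have [_ ki] := kP _ (tau01 i (leq_trans ij jN)); have [_ kj] := kP _ (tau01 j jN).
  have same := kkt_same_support L0 FP ki kj (I := col i); move: same.
  rewrite btB enormZ tauB ger0_norm; last by rewrite divr_ge0 // subr_ge0 ler_nat.
  move=> same.
  have -> : C / gamma / N%:R * (j%:R - i%:R) = gamma^-1 *
      (perturbation_const A G * L * ((j%:R - i%:R) / N%:R * enorm (b1 - b0))).
    by rewrite /C; field; rewrite !gt_eqF.
  rewrite ler_pdivlMl //; apply: same => q; first by rewrite finset.inE.
  by rewrite cij finset.inE.
- move=> i iN.
  have tauS : tau i.+1 - tau i = N%:R^-1.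
    by rewrite tauB -natr1 addrAC subrr add0r mul1r.
  have := mono _ _ (tau01 i (ltnW iN)) (tau01 i.+1 iN); rewrite tauS => H1.
  apply: enorm_le (ltW eta0) _; rewrite -(ler_pM2l g0); apply: le_trans H1 _.
  rewrite mulrC ler_pdivrMr //; apply: le_trans NP.
  have /andP[ti0 ti1] := tau01 _ (ltnW iN); have /andP[tj0 tj1] := tau01 _ iN.
  apply: lerB; apply: smono => //; exact: ler01.
- by rewrite !divr_ge0 // ltW.
- by rewrite lerD2l ler_wpM2r ?(ltW eta0) // /K lerDl.
Qed.

End ErrorBound.

(** * The proximal augmented Lagrangian and its potential *)

Section ProxAugLagrangian.
Context {R : realType}.

Lemma le_of_sqr_le (k e a : R) : 0 <= e -> 0 <= a -> k * e ^+ 2 <= a * e -> k * e <= a.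
Proof.
rewrite le_eqVlt => /predU1P[<-|e0] a0; first by move=> _; rewrite mulr0.
by rewrite expr2 mulrA ler_pM2r.
Qed.

(** The transpose has the same operator norm:
    [|A^T u|^2 = <u, A (A^T u)> <= |u| * sigma_max A * |A^T u|]. *)
Lemma enorm_tr_mulmx_le m n (A : 'M[R]_(m, n)) u :
  enorm (A^T *m u) <= sigma_max A * enorm u.
Proof.
rewrite -[leLHS]mul1r; apply: le_of_sqr_le; rewrite ?mulr_ge0 ?enorm_ge0 ?sigma_max_ge0 //.
rewrite mul1r sqr_enorm -dot_mulmxr; apply: (le_trans (dot_le _ _)).
by rewrite mulrAC [leRHS]mulrC ler_wpM2l ?enorm_ge0 // enorm_mulmx_le.
Qed.

Lemma is_projection_vi n (P : set 'cV[R]_n) u w : segment_closed P ->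
  is_projection P u w -> forall v, P v -> dot (u - w) (v - w) <= 0.
Proof.
move=> Pconv [Pw wmin] v Pv; rewrite -oppr_ge0 -(pmulr_rge0 _ (@ltr0Sn R 1)).
apply: (@ge0_first_order _ _ (dot (v - w) (v - w))) => t t0 t1.
have := wmin _ (Pconv _ _ _ Pw Pv (ltW t0) t1).
rewrite -ler_sqr ?nnegrE ?enorm_ge0 // !sqr_enorm opprD addrA.
by move: (u - w) (v - w) => a d; rewrite !dotE (dotC d a); lra.
Qed.

Context {m n l : nat} (A : 'M[R]_(m, n)) (b : 'cV[R]_m) (G : 'M[R]_(l, n)).
Context (h : 'cV[R]_l) (f : 'cV[R]_n -> R) (Lf p rho : R).
Hypothesis Lf_ge0 : 0 <= Lf.
Hypothesis Lf_lt_p : Lf < p.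
Hypothesis rho_ge0 : 0 <= rho.
Hypothesis df : forall x, differentiable f x.
Hypothesis gradL : forall x x', polyhedron G h x -> polyhedron G h x' ->
  enorm (grad f x - grad f x') <= Lf * enorm (x - x').

Local Notation P := (polyhedron G h).
Local Notation sigma := (sigma_max A).
Local Notation gamma := (p - Lf).
Local Notation LK := (Lf + rho * sigma ^+ 2 + p).

Definition prox_lag z y x := prox_aug_lagrangian A b f rho p x z y.
Definition prox_grad z y x :=
  grad f x + (A^T *m y + rho *: (A^T *m (A *m x - b)) + p *: (x - z)).
Local Notation K := prox_lag.
Local Notation DK := prox_grad.

Lemma gamma_gt0 : 0 < gamma. Proof. by rewrite subr_gt0. Qed.

Lemma p_gt0 : 0 < p. Proof. exact: le_lt_trans Lf_lt_p. Qed.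

Lemma LK_gt0 : 0 < LK.
Proof. by rewrite ltr_wpDl ?p_gt0 // addr_ge0 // mulr_ge0 // sqr_ge0. Qed.

Lemma prox_lagE z y x : K z y x = f x + dot y (A *m x - b)
  + rho / 2 * dot (A *m x - b) (A *m x - b) + p / 2 * dot (x - z) (x - z).
Proof. by rewrite /prox_lag /prox_aug_lagrangian /aug_lagrangian !sqr_enorm. Qed.

Lemma prox_lag_taylor z y x v :
  K z y v - K z y x - dot (DK z y x) (v - x) =
  f v - f x - dot (grad f x) (v - x)
  + rho / 2 * dot (A *m (v - x)) (A *m (v - x)) + p / 2 * dot (v - x) (v - x).
Proof.
rewrite !prox_lagE /prox_grad.
have -> : A *m v - b = A *m (v - x) + (A *m x - b) by rewrite mulmxBr addrA subrK.
have -> : v - z = (v - x) + (x - z) by rewrite addrA subrK.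
move: (v - x) (A *m x - b) (x - z) => d r w.
rewrite !dotE -!dot_mulmxr (dotC (A *m d) r) (dotC d w).
by field.
Qed.

Lemma prox_grad_lipschitz z y x v : P x -> P v ->
  enorm (DK z y x - DK z y v) <= LK * enorm (x - v).
Proof.
move=> Px Pv.
have -> : DK z y x - DK z y v =
    grad f x - grad f v + rho *: (A^T *m (A *m (x - v))) + p *: (x - v).
  rewrite /prox_grad !mulmxBr !scalerBr.
  apply/colP => i; rewrite !mxE; ring.
apply: (le_trans (enormD _ _)); rewrite !mulrDl; apply: lerD; last first.
  by rewrite enormZ ger0_norm // ltW // p_gt0.
apply: (le_trans (enormD _ _)); apply: lerD; first exact: gradL.
rewrite enormZ ger0_norm // expr2 -!mulrA ler_wpM2l //.
apply: (le_trans (enorm_tr_mulmx_le _ _)).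
by rewrite ler_wpM2l ?sigma_max_ge0 // enorm_mulmx_le.
Qed.

Lemma prox_lag_continuous z y : continuous (K z y).
Proof.
rewrite (_ : K z y = fun x => f x + dot y (A *m x - b)
  + rho / 2 * dot (A *m x - b) (A *m x - b) + p / 2 * dot (x - z) (x - z)); last first.
  by apply/funext => x; rewrite prox_lagE.
have rc i : continuous (fun x : 'cV[R]_n => (A *m x - b) i 0).
  rewrite [X in continuous X](_ : _ = fun x : 'cV[R]_n => (A *m x) i 0 - b i 0).
    move=> x; apply: continuousB; last exact: cst_continuous.
    exact: continuous_mulmx_coord.
  by apply/funext => x; rewrite mxE [(- b) i 0]mxE.
have fc : continuous f by move=> x; exact: differentiable_continuous.
have yc : continuous (fun x : 'cV[R]_n => dot y (A *m x - b)).
  by apply: continuous_dot => i; [exact: cst_continuous|exact: rc].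
have Ac : continuous (fun x : 'cV[R]_n => dot (A *m x - b) (A *m x - b)).
  by apply: continuous_dot => i; exact: rc.
have zc : continuous (fun x : 'cV[R]_n => dot (x - z) (x - z)).
  by apply: continuous_dot => i; exact: continuous_coordB.
have scale_cont (k : R) (q : 'cV[R]_n -> R) :
    continuous q -> continuous (fun x => k * q x).
  by move=> qc x; apply: continuousM; [exact: cst_continuous|exact: qc].
move=> x; apply: (continuousD (continuousD (continuousD (fc x) (yc x)) _) _).
  exact: (scale_cont (rho / 2) _ Ac).
exact: (scale_cont (p / 2) _ zc).
Qed.

Lemma prox_lag_strongly_smooth z y : strongly_smooth P (K z y) (DK z y) gamma LK.
Proof.
have taylor x v : P x -> P v ->
    `|f v - f x - dot (grad f x) (v - x)| <= Lf / 2 * dot (v - x) (v - x).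
  by apply: lipschitz_gradient_taylor => // *; exact: polyhedron_segment.
split=> [|x v Px Pv|x v Px Pv|x v Px Pv].
- exact: prox_lag_continuous.
- rewrite prox_lag_taylor; have := taylor _ _ Px Pv; rewrite ler_norml => /andP[].
  have := mulr_ge0 rho_ge0 (dot_ge0 (A *m (v - x))); lra.
- rewrite prox_lag_taylor; have := taylor _ _ Px Pv; rewrite ler_norml => /andP[_].
  have : dot (A *m (v - x)) (A *m (v - x)) <= sigma ^+ 2 * dot (v - x) (v - x).
    rewrite -!sqr_enorm -exprMn ler_sqr ?nnegrE ?mulr_ge0 ?enorm_ge0 ?sigma_max_ge0 //.
    exact: enorm_mulmx_le.
  move=> /(ler_wpM2l rho_ge0); lra.
- exact: prox_grad_lipschitz.
Qed.

Lemma prox_gradB_z z z' y x : DK z' y x = DK z y x + p *: (z - z').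
Proof.
rewrite /prox_grad -!addrA; do 3 congr (_ + _); rewrite -scalerDr.
by rewrite addrA subrK.
Qed.

Lemma prox_lag_z z z' y x :
  K z' y x = K z y x + p / 2 * (dot (x - z') (x - z') - dot (x - z) (x - z)).
Proof. by rewrite !prox_lagE; ring. Qed.

Lemma prox_lag_y z y y' x : K z y' x = K z y x + dot (y' - y) (A *m x - b).
Proof. by rewrite !prox_lagE [dot (y' - y) _]dotDl dotNl; ring. Qed.

(** On a fibre of [A] the dual variable shifts the Lagrangian by a constant. *)
Lemma feasible_vi_dual z y y' b' v : solves_vi (feasible A b' G h) (DK z y) v ->
  solves_vi (feasible A b' G h) (DK z y') v.
Proof.
move=> [Sv vvi]; split => // u Su; have := vvi _ Su.
suff -> : dot (DK z y' v) (u - v) = dot (DK z y v) (u - v) by [].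
rewrite /prox_grad ![dot (grad f v + _) _]dotDl ![dot (_ + p *: _) _]dotDl.
rewrite ![dot (A^T *m _ + _) _]dotDl -!dot_mulmxr.
by case: Sv => /= Av _; case: Su => /= Au _; rewrite mulmxBr Au Av subrr !dot0r.
Qed.

Lemma polyhedron_vi_fibre z y u : solves_vi P (DK z y) u ->
  solves_vi (feasible A (A *m u) G h) (DK z y) u.
Proof. by move=> [Pu uvi]; split => [|v [_ /uvi]]. Qed.

(** The minimiser [u] over [P] also minimises over its own fibre
    [{A v = A u}], so [u] and [v] minimise the same function for two right-hand
    sides. *)
Lemma dual_error_bound z y u v : solves_vi P (DK z y) u ->
  solves_vi (feasible A b G h) (DK z 0) v ->
  gamma * enorm (u - v) <= perturbation_const A G * LK * enorm (A *m u - b).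
Proof.
move=> /polyhedron_vi_fibre uvi /(feasible_vi_dual y) vvi.
apply: (perturbation_bound gamma_gt0 (ltW LK_gt0) _ vvi uvi).
exact: prox_lag_strongly_smooth.
Qed.

(** Moving the centre only translates the gradient, by [p *: (z - z')]. *)
Lemma prox_vi_lipschitz z z' y u u' :
  solves_vi P (DK z y) u -> solves_vi P (DK z' y) u' ->
  gamma * enorm (u' - u) <= p * enorm (z' - z).
Proof.
move=> [Pu uvi] [Pu' uvi'].
apply: le_of_sqr_le; rewrite ?mulr_ge0 ?enorm_ge0 ?(ltW p_gt0) // sqr_enorm.
have := strongly_monotone (prox_lag_strongly_smooth z y) Pu' Pu.
have := uvi _ Pu'; have := uvi' _ Pu; rewrite (prox_gradB_z z).
have := ler_wpM2l (ltW p_gt0) (dot_le (z' - z) (u' - u)).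
rewrite -(opprB u' u) -(opprB z' z).
move: (u' - u) (z' - z) (DK z y u) (DK z y u') => d e g g'.
by rewrite !dotE; lra.
Qed.

(** Test the optimality of [u] at [x'] and the projection inequality of [x'] at
    [u]; their sum bounds [|x - u|^2] by a multiple of [|x - u| * |x - x'|]. *)
Lemma primal_error_bound c z y x x' u : 0 < c -> P x ->
  is_projection P (x - c *: DK z y x) x' -> solves_vi P (DK z y) u ->
  c * gamma * enorm (x - u) <= (1 + c * LK) * enorm (x - x').
Proof.
move=> c0 Px x'P [Pu uvi].
have Pconv : segment_closed P by move=> *; exact: polyhedron_segment.
have Px' : P x' by case: x'P.
apply: le_of_sqr_le; rewrite ?mulr_ge0 ?enorm_ge0 //.
  by rewrite ?addr_ge0 ?mulr_ge0 ?(ltW c0) ?(ltW LK_gt0).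
have := is_projection_vi Pconv x'P Pu.
have := ler_wpM2l (ltW c0) (uvi _ Px').
have := ler_wpM2l (ltW c0)
  (strongly_monotone (prox_lag_strongly_smooth z y) Px Pu).
have := dot_le (x - x') (x - u).
have := ler_wpM2l (ltW c0) (le_trans
  (dot_le (DK z y x - DK z y u) (x - x'))
  (ler_wpM2r (enorm_ge0 (x - x')) (prox_grad_lipschitz z y Px Pu))).
rewrite sqr_enorm.
have -> : x - c *: DK z y x - x' = x - x' - c *: DK z y x by rewrite addrAC.
have -> : u - x' = (x - x') - (x - u) by rewrite opprB [RHS]addrC addrA subrK.
have -> : x' - u = (x - u) - (x - x') by rewrite opprB [RHS]addrC addrA subrK.
move: (x - x') (x - u) (DK z y x) (DK z y u) => e d g g'.
have := dot_ge0 e.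
by rewrite !dotE ?(dotC d e) ?(dotC g e) ?(dotC g' e) ?(dotC g d) ?(dotC g' d); lra.
Qed.

Section Descent.
Context (xbar : 'cV[R]_n -> 'cV[R]_m -> 'cV[R]_n) (xstar : 'cV[R]_n -> 'cV[R]_n).
Hypothesis xbarP : forall z y, solves_vi P (DK z y) (xbar z y).
Hypothesis xstarP : forall z, solves_vi (feasible A b G h) (DK z 0) (xstar z).

(** With [xbar] and [xstar] selecting the minimisers of [K] over [P] and over the
    feasible set, this is [K - 2 d + 2 M] with [d] and [M] the minimal values. *)
Definition potential x y z :=
  K z y x - 2 * K z y (xbar z y) + 2 * K z 0 (xstar z).

Context (c alpha beta : R).
Hypothesis c_gt0 : 0 < c.
Hypothesis c_lt : c * LK <= 1.
Hypothesis alpha_gt0 : 0 < alpha.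
Hypothesis beta_gt0 : 0 < beta.
Hypothesis beta_le1 : beta <= 1.

Definition primal_const := (1 + c * LK) / (c * gamma).
Definition dual_const := perturbation_const A G * LK / gamma.

Lemma primal_const_ge0 : 0 <= primal_const.
Proof.
have g0 := gamma_gt0; have L0 := LK_gt0.
by rewrite divr_ge0 ?addr_ge0 ?mulr_ge0 ?(ltW c_gt0) ?(ltW g0) ?(ltW L0).
Qed.

Lemma dual_const_ge0 : 0 <= dual_const.
Proof.
by rewrite divr_ge0 ?mulr_ge0 ?perturbation_const_ge0 ?(ltW LK_gt0) ?(ltW gamma_gt0).
Qed.

Context (x x' z z' : 'cV[R]_n) (y y' : 'cV[R]_m).
Hypothesis Px : P x.
Hypothesis y'E : y' = y + alpha *: (A *m x - b).
Hypothesis x'P : is_projection P (x - c *: DK z y' x) x'.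
Hypothesis z'E : z' = z + beta *: (x' - z).

Local Notation r := (A *m xbar z y' - b).

Lemma dual_stepE : y' - y = alpha *: (A *m x - b).
Proof. by rewrite y'E addrC addKr. Qed.

Lemma center_stepE : z' - z = beta *: (x' - z).
Proof. by rewrite z'E addrC addKr. Qed.

Lemma primal_bound : enorm (x - xbar z y') <= primal_const * enorm (x - x').
Proof.
have := primal_error_bound c_gt0 Px x'P (xbarP z y').
by move=> H; rewrite /primal_const mulrAC ler_pdivlMr ?mulr_gt0 ?gamma_gt0 // mulrC.
Qed.

Lemma dual_bound z0 y0 :
  enorm (xbar z0 y0 - xstar z0) <= dual_const * enorm (A *m xbar z0 y0 - b).
Proof.
have := dual_error_bound (xbarP z0 y0) (xstarP z0).
by move=> H; rewrite /dual_const mulrAC ler_pdivlMr ?gamma_gt0 // mulrC.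
Qed.

(** The dual step uses the infeasibility at [x] in place of that at the minimiser
    [xbar z y'], which would be the gradient of the dual function. *)
Lemma infeasibility_bound :
  enorm (A *m x - b - r) <= sigma * primal_const * enorm (x - x').
Proof.
rewrite opprB addrA subrK -mulmxBr; apply: (le_trans (enorm_mulmx_le _ _)).
by rewrite -mulrA ler_wpM2l ?sigma_max_ge0 // primal_bound.
Qed.

(** Sufficient decrease of a projected gradient step; [c * LK <= 1] makes half of
    [|x - x'|^2 / c] absorb the quadratic Taylor term. *)
Lemma projected_step_descent :
  K z y' x' + dot (x - x') (x - x') / (2 * c) <= K z y' x.
Proof.
have Pconv : segment_closed P by move=> *; exact: polyhedron_segment.
have Px' : P x' by case: x'P.
have := is_projection_vi Pconv x'P Px.
have [_ _ /(_ _ _ Px Px') up _] := prox_lag_strongly_smooth z y'.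
move: up; rewrite -(opprB x x').
have -> : x - c *: DK z y' x - x' = x - x' - c *: DK z y' x by rewrite addrAC.
have := dot_ge0 (x - x').
move: (x - x') (DK z y' x) => e g; rewrite dotDl !dotNl !dotNr dotZl opprK.
move=> e0 up proj.
have H1 : dot e e / c <= dot g e by rewrite ler_pdivrMr // [leRHS]mulrC; lra.
have H2 : LK * dot e e <= dot e e / c.
  by rewrite ler_pdivlMr // mulrC mulrA ler_piMl.
have -> : dot e e / (2 * c) = dot e e / c / 2 by field; rewrite gt_eqF.
lra.
Qed.

Lemma center_step_descent : K z' y' x' + p * beta / 2 * dot (x' - z) (x' - z)
  <= K z y' x'.
Proof.
rewrite (prox_lag_z z z') z'E.
have -> : x' - (z + beta *: (x' - z)) = (1 - beta) *: (x' - z).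
  by rewrite scalerBl scale1r opprD addrA.
rewrite dotZl dotZr.
have := mulr_ge0 (ltW p_gt0) (dot_ge0 (x' - z)).
move: (dot (x' - z) (x' - z)) => w w0.
have : 0 <= (p * w) * (beta * (1 - beta)).
  by rewrite mulr_ge0 // mulr_ge0 ?subr_ge0 // ltW.
lra.
Qed.

(** The dual value is a minimum, so it is compared at the minimiser of the new
    function for a lower bound, and at that of the old one for an upper bound;
    the next three lemmas follow this pattern. *)
Lemma dual_ascent_y :
  K z y (xbar z y) + alpha * dot (A *m x - b) r <= K z y' (xbar z y').
Proof.
have g0 := mulr_ge0 (ltW gamma_gt0) (dot_ge0 (xbar z y' - xbar z y)).
have [_ H] := xbarP z y; have [Pu _] := xbarP z y'.
have := solves_vi_min (prox_lag_strongly_smooth z y) (@subset_refl _ P) (xbarP z y) Pu.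
rewrite (prox_lag_y z y y') dual_stepE dotZl; lra.
Qed.

Lemma dual_ascent_z :
  K z y' (xbar z y') + p / 2 * (dot (xbar z' y' - z') (xbar z' y' - z')
     - dot (xbar z' y' - z) (xbar z' y' - z)) <= K z' y' (xbar z' y').
Proof.
have g0 := mulr_ge0 (ltW gamma_gt0) (dot_ge0 (xbar z' y' - xbar z y')).
have [Pu _] := xbarP z' y'.
have := solves_vi_min (prox_lag_strongly_smooth z y') (@subset_refl _ P) (xbarP z y') Pu.
by rewrite (prox_lag_z z z'); lra.
Qed.

Lemma value_step : K z' 0 (xstar z') <= K z 0 (xstar z)
  + p / 2 * (dot (xstar z - z') (xstar z - z') - dot (xstar z - z) (xstar z - z)).
Proof.
have g0 := mulr_ge0 (ltW gamma_gt0) (dot_ge0 (xstar z - xstar z')).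
have FP : feasible A b G h `<=` P by move=> u [].
have := solves_vi_min (prox_lag_strongly_smooth z' 0) FP (xstarP z') (xstarP z).1.
by rewrite (prox_lag_z z z' 0 (xstar z)); lra.
Qed.

(** The dual step raises [K] by [alpha |A x - b|^2] and lowers [- 2 d] by
    [2 alpha <A x - b, r>], which leaves [- alpha |r|^2] up to
    [alpha |A (x - xbar)|^2]. The moves of the centre in [d] and in [M] cancel up
    to [2 p beta <x' - z, xbar' - xstar>], where [xbar'] is the minimiser after
    the step. The error bounds turn these remainders into multiples of
    [alpha |x - x'|^2], [beta^2 |x' - z|^2] and [beta |r|^2], plus half of the
    gain [p beta |x' - z|^2 / 2]; the step size conditions absorb them. *)
Lemma potential_descent :
  4 * c * alpha * (sigma * primal_const) ^+ 2 <= 1 ->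
  16 * p * beta <= gamma ->
  8 * p * dual_const ^+ 2 * beta <= alpha ->
  potential x' y' z' + dot (x - x') (x - x') / (4 * c)
    + p * beta / 8 * dot (x' - z) (x' - z) + alpha / 2 * dot r r
  <= potential x y z.
Proof.
move=> alpha_le beta_le beta_alpha.
have y'_step : K z y' x = K z y x + alpha * dot (A *m x - b) (A *m x - b).
  by rewrite (prox_lag_y z y y') dual_stepE dotZl.
have infeas : dot (A *m x - b) (A *m x - b) - 2 * dot (A *m x - b) r
    <= (sigma * primal_const) ^+ 2 * dot (x - x') (x - x') - dot r r.
  have : dot (A *m x - b - r) (A *m x - b - r)
      <= (sigma * primal_const) ^+ 2 * dot (x - x') (x - x').
    rewrite -!sqr_enorm -exprMn ler_sqr ?nnegrE ?enorm_ge0 ?infeasibility_bound //.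
    exact: mulr_ge0 (mulr_ge0 (sigma_max_ge0 A) primal_const_ge0) (enorm_ge0 _).
  move: (A *m x - b) r => u v; rewrite !dotE (dotC v u); lra.
have centers : (dot (xstar z - z') (xstar z - z') - dot (xstar z - z) (xstar z - z))
    - (dot (xbar z' y' - z') (xbar z' y' - z')
       - dot (xbar z' y' - z) (xbar z' y' - z))
    = 2 * beta * dot (x' - z) (xbar z' y' - xstar z).
  have -> : xbar z' y' - xstar z = (xbar z' y' - z) - (xstar z - z).
    by rewrite opprB addrA subrK.
  have -> : xstar z - z' = xstar z - z - beta *: (x' - z) by rewrite z'E opprD addrA.
  have -> : xbar z' y' - z' = xbar z' y' - z - beta *: (x' - z).
    by rewrite z'E opprD addrA.
  move: (xbar z' y' - z) (xstar z - z) (x' - z) => u v w.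
  by rewrite !dotE (dotC w u) (dotC w v); ring.
have cross : dot (x' - z) (xbar z' y' - xstar z) <=
    p / gamma * beta * dot (x' - z) (x' - z)
    + dual_const * enorm (x' - z) * enorm r.
  have -> : xbar z' y' - xstar z = (xbar z' y' - xbar z y') + (xbar z y' - xstar z).
    by rewrite addrA subrK.
  rewrite dotDr; apply: lerD; apply: (le_trans (dot_le _ _)); last first.
    rewrite [dual_const * _]mulrC -mulrA ler_wpM2l ?enorm_ge0 //.
    exact: dual_bound.
  rewrite -sqr_enorm.
  rewrite (_ : p / gamma * beta * enorm (x' - z) ^+ 2 =
      enorm (x' - z) * (gamma^-1 * (p * (beta * enorm (x' - z))))); last by ring.
  rewrite ler_wpM2l ?enorm_ge0 // ler_pdivlMl ?gamma_gt0 //.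
  have := prox_vi_lipschitz (xbarP z y') (xbarP z' y').
  by rewrite center_stepE enormZ gtr0_norm.
have young : 2 * (dual_const * enorm (x' - z) * enorm r) <=
    dot (x' - z) (x' - z) / 4 + 4 * dual_const ^+ 2 * dot r r.
  rewrite -!sqr_enorm.
  have := sqr_ge0 (enorm (x' - z) / 2 - 2 * dual_const * enorm r); nra.
have e0 := dot_ge0 (x - x'); have w0 := dot_ge0 (x' - z); have r0 := dot_ge0 r.
have step_le : alpha * ((sigma * primal_const) ^+ 2 * dot (x - x') (x - x'))
    <= dot (x - x') (x - x') / (4 * c).
  rewrite ler_pdivlMr ?mulr_gt0 // mulrA mulrAC ler_piMl //.
  by rewrite (le_trans _ alpha_le) //; lra.
have center_le : p / gamma * beta * dot (x' - z) (x' - z)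
    <= dot (x' - z) (x' - z) / 16.
  rewrite [leRHS]mulrC ler_wpM2r //.
  rewrite (_ : _ * beta = gamma^-1 * (p * beta)); last by ring.
  by rewrite ler_pdivrMl ?gamma_gt0 //; lra.
have dual_le : p * beta * (4 * dual_const ^+ 2 * dot r r) <= alpha / 2 * dot r r.
  by rewrite mulrA ler_wpM2r //; lra.
have pb0 : 0 <= p * beta by rewrite mulr_ge0 ?(ltW p_gt0) ?(ltW beta_gt0).
have weighted_cross : p * beta * (2 * dot (x' - z) (xbar z' y' - xstar z)) <=
    p * beta * (3 / 8 * dot (x' - z) (x' - z) + 4 * dual_const ^+ 2 * dot r r).
  by rewrite ler_wpM2l //; lra.
have := ler_wpM2l (ltW alpha_gt0) infeas.
have := congr1 (fun t => p * t) centers => /=.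
have halves : dot (x - x') (x - x') / (2 * c) = 2 * (dot (x - x') (x - x') / (4 * c)).
  by field; rewrite gt_eqF.
have := projected_step_descent; have := center_step_descent.
have := dual_ascent_y; have := dual_ascent_z; have := value_step.
rewrite /potential halves y'_step; lra.
Qed.

(** The first line bounds the coefficients in the estimate of [A *m x' - b], the
    second those in the estimate of the stationarity residual. *)
Definition residual_const := sigma * (1 + primal_const) + 1
  + (Lf + c^-1 + p + rho * sigma * (sigma * primal_const + 1)).

Lemma residual_const_ge1 : 1 <= residual_const.
Proof.
have s0 := sigma_max_ge0 A; have p0 := primal_const_ge0.
have pp := ltW p_gt0; have ci : 0 <= c^-1 by rewrite invr_ge0 ltW.
have h1 := mulr_ge0 s0 (addr_ge0 ler01 p0).
have h2 := mulr_ge0 (mulr_ge0 rho_ge0 s0) (addr_ge0 (mulr_ge0 s0 p0) ler01).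
by have := Lf_ge0; rewrite /residual_const; lra.
Qed.

(** The projection supplies the normal vector: [x - c *: DK - x'] is normal to
    [P] at [x'], and so is its quotient by [c]. Added to the gradient of the
    Lagrangian at [x'], it cancels the gradient at [x] and the multiplier term,
    up to quantities that the potential pays for. *)
Lemma step_eps_stationary : eps_stationary A b G h f
  (residual_const * (enorm (x - x') + enorm (x' - z) + enorm r)) x' y'.
Proof.
have Pconv : segment_closed P by move=> *; exact: polyhedron_segment.
have Px' : P x' by case: x'P.
have s0 := sigma_max_ge0 A.
move: infeasibility_bound primal_const_ge0; rewrite /residual_const.
move: primal_const => pc infeas p0.
have L0 := Lf_ge0; have pp := ltW p_gt0; have ci : 0 <= c^-1 by rewrite invr_ge0 ltW.
have e0 := enorm_ge0 (x - x'); have w0 := enorm_ge0 (x' - z).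
have r0 := enorm_ge0 r.
have feas : enorm (A *m x - b) <= sigma * pc * enorm (x - x') + enorm r.
  have -> : A *m x - b = (A *m x - b - r) + r by rewrite subrK.
  by apply: (le_trans (enormD _ _)); rewrite lerD2r.
split.
  have -> : A *m x' - b = (A *m x - b) - A *m (x - x').
    by rewrite mulmxBr opprB [RHS]addrC addrA subrK.
  apply: (le_trans (enormB _ _)).
  have := enorm_mulmx_le A (x - x'); move: feas.
  have q2 : 0 <= (Lf + c^-1 + p + rho * sigma * (sigma * pc + 1)) *
      (enorm (x - x') + enorm (x' - z) + enorm r).
    by do ?[apply: mulr_ge0 | apply: addr_ge0] => //.
  have q1 : 0 <= sigma * (1 + pc) * (enorm (x' - z) + enorm r).
    by do ?[apply: mulr_ge0 | apply: addr_ge0] => //.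
  rewrite mulrDl; lra.
exists (c^-1 *: (x - x') - DK z y' x).
  move=> v; rewrite /indicator (mem_set Px').
  case: (boolP (v \in P)) => [/set_mem Pv|_]; last exact: leey.
  rewrite add0e lee_fin.
  have := is_projection_vi Pconv x'P Pv.
  have -> : x - c *: DK z y' x - x' = c *: (c^-1 *: (x - x') - DK z y' x).
    by rewrite scalerBr scalerA divff ?gt_eqF // scale1r addrAC.
  by rewrite dotZl pmulr_rle0.
have -> : grad f x' + A^T *m y' + (c^-1 *: (x - x') - DK z y' x) =
    (grad f x' - grad f x) + c^-1 *: (x - x')
    - (rho *: (A^T *m (A *m x - b)) + p *: (x - z)).
  rewrite /prox_grad; apply/colP => i; rewrite !mxE; ring.
apply: (le_trans (enormB _ _)).
apply: (le_trans (lerD (enormD _ _) (enormD _ _))).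
rewrite !enormZ !ger0_norm //.
have -> : x - z = (x - x') + (x' - z) by rewrite addrA subrK.
have lip := gradL Px' Px; rewrite [enorm (x' - x)]enorm_distC in lip.
have xz := ler_wpM2l pp (enormD (x - x') (x' - z)).
have Atr := ler_wpM2l rho_ge0 (le_trans (enorm_tr_mulmx_le A (A *m x - b))
  (ler_wpM2l s0 feas)).
have q1 : 0 <= (sigma * (1 + pc) + 1) *
    (enorm (x - x') + enorm (x' - z) + enorm r).
  by do ?[apply: mulr_ge0 | apply: addr_ge0] => //.
have q2 : 0 <= (Lf + c^-1) * (enorm (x' - z) + enorm r).
  by do ?[apply: mulr_ge0 | apply: addr_ge0] => //.
have q3 : 0 <= rho * sigma * (sigma * pc) * (enorm (x' - z) + enorm r).
  by do ?[apply: mulr_ge0 | apply: addr_ge0] => //.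
have q4 : 0 <= rho * sigma * (enorm (x - x') + enorm (x' - z)).
  by do ?[apply: mulr_ge0 | apply: addr_ge0] => //.
have q5 : 0 <= p * enorm r by rewrite mulr_ge0.
rewrite mulrDl; lra.
Qed.

End Descent.

End ProxAugLagrangian.

(** * From sufficient decrease to complexity *)

Section Rate.
Context {R : realType} {m n l : nat} (A : 'M[R]_(m, n)) (b : 'cV[R]_m).
Context (G : 'M[R]_(l, n)) (h : 'cV[R]_l) (f : 'cV[R]_n -> R).

Lemma eps_stationary_le (e e' : R) x y : e <= e' ->
  eps_stationary A b G h f e x y -> eps_stationary A b G h f e' x y.
Proof.
move=> ee' [Ax [xi xiP xile]]; split; first exact: le_trans ee'.
by exists xi => //; exact: le_trans ee'.
Qed.

Section Sequences.
Context (x : nat -> 'cV[R]_n) (y : nat -> 'cV[R]_m).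

(** The iteration count [B / eps ^+ 2] is the rate [sqrt (B / t)] read at the
    least [t] with [B / eps ^+ 2 <= t]. *)
Lemma stationary_rate_from_average (B : R) : 0 < B ->
  (forall t : nat, (0 < t)%N -> exists2 s : nat, (s < t)%N
     & eps_stationary A b G h f (Num.sqrt B / Num.sqrt t%:R) (x s.+1) (y s.+1)) ->
  stationary_rate A b G h f x y B.
Proof.
move=> B0 avg; split=> // eps eps0.
pose q t := B / eps ^+ 2 <= t%:R.
have qex : exists t, q t.
  by exists (Num.truncn (B / eps ^+ 2)).+1; rewrite /q ltW // truncnS_gt.
case: (ex_minnP qex) => t qt tmin.
have t0 : (0 < t)%N.
  by rewrite -(ltr0n R) (lt_le_trans _ qt) // divr_gt0 // exprn_gt0.
have [s st sP] := avg t t0; exists s.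
  by rewrite ltNge; apply/negP => /tmin; rewrite leqNgt st.
apply: eps_stationary_le sP.
have t0R : 0 < (t%:R : R) by rewrite ltr0n.
rewrite ler_pdivrMr ?sqrtr_gt0 // -ler_sqr ?nnegrE ?sqrtr_ge0 //; last first.
  by rewrite mulr_ge0 ?sqrtr_ge0 // ltW.
by rewrite exprMn !sqr_sqrtr ?(ltW B0) ?(ltW t0R) // mulrC -ler_pdivrMr ?exprn_gt0.
Qed.

Context (phi eps : nat -> R) (D lb : R).
Hypothesis D_gt0 : 0 < D.
Hypothesis eps_ge0 : forall t, 0 <= eps t.
Hypothesis epsP : forall t, eps_stationary A b G h f (eps t) (x t.+1) (y t.+1).
Hypothesis decrease : forall t, eps t ^+ 2 <= D * (phi t - phi t.+1).
Hypothesis phi_ge : forall t, lb <= phi t.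

(** If all of the first [t] residuals exceeded [sqrt (B / t)], their squares would
    add up to more than the total decrease [B]. *)
Lemma stationary_rate_of_decrease (B : R) : 0 < B -> D * (phi 0%N - lb) <= B ->
  stationary_rate A b G h f x y B.
Proof.
move=> B0 BP; apply: stationary_rate_from_average => // -[//|t] _.
have t0 : 0 < (t.+1%:R : R) by rewrite ltr0n.
apply: contrapT => bad.
have big s : (s < t.+1)%N -> B / t.+1%:R < eps s ^+ 2.
  move=> st; rewrite ltNge; apply/negP => le_s; apply: bad; exists s => //.
  apply: eps_stationary_le (epsP s).
  rewrite -sqrtrV ?(ltW t0) // -sqrtrM ?(ltW B0) //.
  by rewrite -[leLHS]ger0_norm // -sqrtr_sqr ler_wsqrtr.
have tB : (t%:R + 1) * (B / t.+1%:R) = B by rewrite natr1 mulrC divfK // gt_eqF.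
move: (B / t.+1%:R) big tB => a big tB.
have sum k : (k <= t)%N -> k%:R * a <= D * (phi 0%N - phi k).
  elim: k => [_|k IH kt]; first by rewrite mul0r subrr mulr0.
  have := IH (ltnW kt); have := big k (leq_trans kt (leqnSn t)).
  by have := decrease k; rewrite -[k.+1%:R]natr1; lra.
have := sum t (leqnn t); have := big t (ltnSn t); have := decrease t.
have := ler_wpM2l (ltW D_gt0) (phi_ge t.+1); lra.
Qed.

(** The squares are dominated by the increments of a convergent sequence. *)
Lemma residual_cvg0 (d : R) : 0 < d -> exists T, forall t, (T <= t)%N -> eps t <= d.
Proof.
move=> d0.
have phi_mono t : phi t.+1 <= phi t.
  have := le_trans (sqr_ge0 _) (decrease t).
  by rewrite pmulr_rge0 // subr_ge0.
have phi_le T t : (T <= t)%N -> phi t <= phi T.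
  move=> /subnKC <-; elim: (t - T)%N => [|k IH]; first by rewrite addn0.
  by rewrite addnS (le_trans (phi_mono _)).
have hi : has_inf (range phi).
  by split; [exists (phi 0%N), 0%N|exists lb => _ [t _ <-]].
have dD0 : 0 < d ^+ 2 / D by rewrite divr_gt0 // exprn_gt0.
have [_ [T _ <-] phiT] := inf_adherent dD0 hi.
exists T => t Tt; rewrite -ler_sqr ?nnegrE ?(ltW d0) //.
apply: le_trans (decrease t) _; rewrite mulrC -ler_pdivlMr //.
have := phi_le _ _ Tt; have : inf (range phi) <= phi t.+1.
  by apply: ge_inf; [exact: hi.2|exists t.+1].
lra.
Qed.

End Sequences.

(** For [t >= 2], reading the rate one iterate later costs a factor 2, as
    [t <= 2 * (t - 1)]; for [t = 1], the residual [e1] of the first iterate is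
    added to the constant. *)
Lemma stationary_rate_shift x y (B : R) : polyhedron G h (x 1%N) -> 0 < B ->
  stationary_rate A b G h f (fun t => x t.+1) (fun t => y t.+1) B ->
  exists2 B' : R, 0 < B' & stationary_rate A b G h f x y B'.
Proof.
move=> Px1 B0 [_ rate].
pose e1 := enorm (A *m x 1%N - b) + enorm (grad f (x 1%N) + A^T *m y 1%N).
have e10 : 0 <= e1 by rewrite addr_ge0 ?enorm_ge0.
have B'0 : 0 < 2 * B + e1 ^+ 2 by have := sqr_ge0 e1; lra.
exists (2 * B + e1 ^+ 2) => //.
apply: stationary_rate_from_average => // -[//|[|t]] _.
  exists 0%N => //; apply: (@eps_stationary_le e1).
    rewrite sqrtr1 divr1 -ler_sqr ?nnegrE ?sqrtr_ge0 // sqr_sqrtr ?(ltW B'0) //.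
    by lra.
  split; first by rewrite lerDl enorm_ge0.
  exists 0; last by rewrite addr0 lerDr enorm_ge0.
  move=> v; rewrite dot0l adde0 /indicator (mem_set Px1).
  by case: ifP => // _; exact: leey.
have [s st sP] := rate t.+1 isT; exists s.+1 => //.
apply: eps_stationary_le sP.
have t0 (k : nat) : 0 < (k.+1%:R : R) by rewrite ltr0n.
rewrite -!sqrtrV ?(ltW (t0 _)) // -!sqrtrM ?(ltW B0) ?(ltW B'0) //; apply: ler_wsqrtr.
rewrite ler_pdivrMr // mulrAC ler_pdivlMr //.
have := sqr_ge0 e1; have := t0 t; rewrite -[t.+2%:R]natr1 -[t.+1%:R]natr1.
have : 0 <= t%:R :> R by exact: ler0n.
nra.
Qed.

End Rate.

(** * Limit points *)

Section LimitPoints.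
Context {R : realType} {m n l : nat} (A : 'M[R]_(m, n)) (b : 'cV[R]_m).
Context (G : 'M[R]_(l, n)) (h : 'cV[R]_l) (f : 'cV[R]_n -> R) (Lf : R).
Hypothesis Lf_ge0 : 0 <= Lf.
Hypothesis gradL : forall x x', polyhedron G h x -> polyhedron G h x' ->
  enorm (grad f x - grad f x') <= Lf * enorm (x - x').

Lemma le_of_vanishing (a c C : R) : 0 <= C ->
  (forall d, 0 < d -> d <= 1 -> a <= c + d * C) -> a <= c.
Proof.
move=> C0 H; apply/ler_addgt0Pr => e e0.
have C1 : 0 < C + 1 by rewrite ltr_wpDl.
have d0 : 0 < Num.min 1 (e / (C + 1)) by rewrite lt_min ltr01 divr_gt0.
apply: le_trans (H _ d0 _) _; first by rewrite ge_min lexx.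
rewrite lerD2l; apply: le_trans (_ : e / (C + 1) * C <= _).
  by rewrite ler_wpM2r // ge_min lexx orbT.
by rewrite mulrAC ler_pdivrMr // ler_pM2l // lerDl.
Qed.

(** The variational inequality that defines a KKT point passes to the limit,
    the gradient being Lipschitz; the multipliers are then recovered from it. *)
Lemma KKT_point_of_approximations xs ys :
  (forall d : R, 0 < d -> exists x y, [/\ polyhedron G h x,
     eps_stationary A b G h f d x y, enorm (x - xs) <= d & enorm (y - ys) <= d]) ->
  KKT_point A b G h f xs ys.
Proof.
move=> approx.
have Pxs : polyhedron G h xs.
  move=> i; apply: (@le_of_vanishing _ _ (sigma_max G)) => [|d d0 d1].
    exact: sigma_max_ge0.
  have [x [y [Px _ xxs _]]] := approx d d0.
  have -> : (G *m xs) i 0 = (G *m x) i 0 + (G *m (xs - x)) i 0.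
    by rewrite -!dot_row -dotDr addrC subrK.
  apply: lerD; first exact: Px.
  apply: le_trans (ler_norm _) _; apply: le_trans (normr_coord_le _ _) _.
  apply: le_trans (enorm_mulmx_le _ _) _.
  by rewrite mulrC ler_wpM2r ?sigma_max_ge0 // enorm_distC.
have Axs : A *m xs - b = 0.
  apply: enorm_eq0; apply/eqP; rewrite eq_le enorm_ge0 andbT.
  apply: (@le_of_vanishing _ _ (1 + sigma_max A)) => [|d d0 d1].
    by rewrite addr_ge0 ?sigma_max_ge0.
  have [x [y [Px [Ax _] xxs _]]] := approx d d0.
  have -> : A *m xs - b = (A *m x - b) - A *m (x - xs).
    by rewrite mulmxBr opprB [RHS]addrC addrA subrK.
  apply: le_trans (enormB _ _) _; rewrite add0r mulrDr mulr1; apply: lerD => //.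
  apply: le_trans (enorm_mulmx_le _ _) _.
  by rewrite mulrC ler_wpM2r ?sigma_max_ge0.
pose q := grad f xs + A^T *m ys.
have vi v : polyhedron G h v -> 0 <= dot q (v - xs).
  move=> Pv; pose M := Lf + sigma_max A; pose D := enorm (v - xs).
  have M0 : 0 <= M by rewrite addr_ge0 ?sigma_max_ge0.
  have D0 : 0 <= D by exact: enorm_ge0.
  have q0 : 0 <= enorm q by exact: enorm_ge0.
  apply: (@le_of_vanishing _ _ (1 + D + (enorm q + M) + M * D)) => [|d d0 d1].
    by do ?[apply: mulr_ge0 | apply: addr_ge0] => //; exact: sigma_max_ge0.
  have [x [y [Px [_ [xi xiP xid]] xxs yys]]] := approx d d0.
  have xiv : dot xi (v - x) <= 0.
    have := xiP v; rewrite /indicator (mem_set Px) (mem_set Pv) add0e.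
    by rewrite lee_fin.
  pose g := grad f x + A^T *m y.
  have gq : enorm (g - q) <= M * d.
    have -> : g - q = (grad f x - grad f xs) + A^T *m (y - ys).
      by rewrite /g /q mulmxBr opprD addrACA.
    apply: le_trans (enormD _ _) _; rewrite mulrDl; apply: lerD.
      by apply: le_trans (gradL Px Pxs) _; rewrite ler_wpM2l.
    apply: le_trans (enorm_tr_mulmx_le _ _) _.
    by rewrite ler_wpM2l ?sigma_max_ge0.
  have gv : - (d * (D + d)) <= dot g (v - x).
    have vx : enorm (v - x) <= D + d.
      apply: le_trans (enorm_triangle xs _ _) _; rewrite lerD2l.
      by rewrite enorm_distC.
    have := dot_geN (g + xi) (v - x); rewrite dotDl.
    have := ler_pM (enorm_ge0 _) (enorm_ge0 _) xid vx; rewrite -/g; lra.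
  have gx : - ((enorm q + M) * d) <= dot g (x - xs).
    have gle : enorm g <= enorm q + M.
      have -> : g = q + (g - q) by rewrite addrC subrK.
      apply: le_trans (enormD _ _) _; rewrite lerD2l (le_trans gq) //.
      by rewrite ler_piMr.
    have := dot_geN g (x - xs).
    have := ler_pM (enorm_ge0 _) (enorm_ge0 _) gle xxs; lra.
  have dg : - (M * d * D) <= dot (q - g) (v - xs).
    have := dot_geN (q - g) (v - xs); rewrite -/D [enorm (q - g)]enorm_distC.
    have := ler_wpM2r D0 gq; lra.
  have -> : dot q (v - xs) = dot g (v - x) + dot g (x - xs) + dot (q - g) (v - xs).
    have -> : v - xs = (v - x) + (x - xs) by rewrite addrA subrK.
    move: (v - x) (x - xs) => u w.
    by rewrite [dot (q - g) _]dotDl dotNl [dot g (u + w)]dotDr; ring.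
  have : d * d <= d by rewrite ler_piMr // ltW.
  lra.
have [mu [qmu mu0 muc]] := polyhedron_multipliers Pxs vi.
by exists mu.
Qed.

Lemma cluster_KKT_point (x : nat -> 'cV[R]_n) (y : nat -> 'cV[R]_m) xs ys :
  (forall d : R, 0 < d -> exists T, forall t, (T <= t)%N ->
     polyhedron G h (x t) /\ eps_stationary A b G h f d (x t) (y t)) ->
  cluster ((fun t : nat => (x t, y t)) @ \oo) (xs, ys) ->
  KKT_point A b G h f xs ys.
Proof.
move=> xyP cl; apply: KKT_point_of_approximations => d d0.
pose Q := [set q : 'cV[R]_n * 'cV[R]_m | polyhedron G h q.1 /\
  eps_stationary A b G h f d q.1 q.2].
pose V := [set q : 'cV[R]_n * 'cV[R]_m | enorm (q.1 - xs) < d /\ enorm (q.2 - ys) < d].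
have QF : ((fun t : nat => (x t, y t)) @ \oo) Q.
  by have [T TP] := xyP d d0; exists T => // t /= /TP.
have Vn : nbhs (xs, ys) V.
  exists ([set u | enorm (u - xs) < d], [set u | enorm (u - ys) < d]).
    by split => /=; exact: near_enorm.
  by move=> [u v] /= [].
have [[u v] [[Pu uv] [us vs]]] := cl Q V QF Vn.
by exists u, v; split => //; apply: ltW.
Qed.

End LimitPoints.

(** * Runs of the algorithm *)

Section Run.
Context {R : realType} {m n l : nat} (A : 'M[R]_(m, n)) (G : 'M[R]_(l, n)).
Context (Lf p rho c : R).
Hypothesis Lf_ge0 : 0 <= Lf.
Hypothesis Lf_lt_p : Lf < p.
Hypothesis rho_ge0 : 0 <= rho.
Hypothesis c_gt0 : 0 < c.
Local Notation sigma := (sigma_max A).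
Local Notation gamma := (p - Lf).
Local Notation LK := (Lf + rho * sigma ^+ 2 + p).
Hypothesis c_lt : c * LK <= 1.

(** Bounds on the gradient of the proximal Lagrangian at the starting point and
    on the distances from it to the two minimisers of the potential. *)
Definition start_grad r := r * (1 + sigma + rho * sigma + p).
Definition start_xbar r := start_grad r / gamma.
Definition start_xstar r :=
  start_xbar r + dual_const A G Lf p rho * (r + sigma * start_xbar r).
Definition start_const r := r ^+ 2 * (1 + rho / 2 + p / 2)
  + 2 * start_grad r * (start_xbar r + start_xstar r) + LK * start_xstar r ^+ 2.

(** [residual_const ^+ 2] times the largest of the inverses of the three
    coefficients in [potential_descent], bounded by their sum; the factor 3 is
    from [sqr_sum3_le]. *)
Definition decrease_const alpha beta := 3 * residual_const A Lf p rho c ^+ 2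
  * (4 * c + 8 / (p * beta) + 2 / alpha).

Context (b : 'cV[R]_m) (h : 'cV[R]_l) (f : 'cV[R]_n -> R) (f_lb : R).
Hypothesis adm : admissible A b G h f Lf f_lb.
Local Notation P := (polyhedron G h).
Local Notation K := (prox_lag A b f p rho).
Local Notation DK := (prox_grad A b f p rho).

Lemma adm_smooth z y : strongly_smooth P (K z y) (DK z y) gamma LK.
Proof. by case: adm => _ df gradL _; exact: prox_lag_strongly_smooth. Qed.

Section Potential.
Context (xbar : 'cV[R]_n -> 'cV[R]_m -> 'cV[R]_n) (xstar : 'cV[R]_n -> 'cV[R]_n).
Hypothesis xbarP : forall z y, solves_vi P (DK z y) (xbar z y).
Hypothesis xstarP : forall z, solves_vi (feasible A b G h) (DK z 0) (xstar z).
Local Notation potential := (potential A b f p rho xbar xstar).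

Let g0 : 0 < gamma. Proof. exact: gamma_gt0. Qed.

(** On the feasible set the Lagrangian does not see the dual variable. *)
Lemma value_dual_indep z y : K z y (xstar z) = K z 0 (xstar z).
Proof.
rewrite (prox_lag_y _ _ _ _ _ z 0 y).
by have [[/= -> _] _] := xstarP z; rewrite subrr dot0r addr0.
Qed.

(** The potential is [(K - d) + (M - d) + M], where [d <= K] and [d <= M]
    because [x] and [xstar z] both lie in [P]. *)
Lemma potential_ge x y z : P x -> f_lb <= potential x y z.
Proof.
move=> Px; have [_ _ _ flb] := adm.
have [Fs _] := xstarP z.
have h1 := solves_vi_min (adm_smooth z y) (@subset_refl _ P) (xbarP z y) Px.
have h2 := solves_vi_min (adm_smooth z y) (@subset_refl _ P) (xbarP z y) Fs.2.
rewrite value_dual_indep in h2.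
have h3 : f_lb <= K z 0 (xstar z).
  rewrite prox_lagE dot0l addr0; case: Fs (flb _ Fs) => /= -> _ /ltW fs.
  rewrite subrr dot0l mulr0 addr0 (le_trans fs) // lerDl.
  by rewrite mulr_ge0 ?dot_ge0 // divr_ge0 // (ltW (p_gt0 Lf_ge0 Lf_lt_p)).
have := mulr_ge0 (ltW g0) (dot_ge0 (x - xbar z y)).
have := mulr_ge0 (ltW g0) (dot_ge0 (xstar z - xbar z y)).
rewrite /potential; lra.
Qed.

(** [xbar] is close to the starting point because the gradient there is bounded,
    [xstar] because of the dual error bound. *)
Lemma potential_start x y z r : P x -> enorm (grad f x) <= r -> enorm y <= r ->
  enorm (x - z) <= r -> enorm (A *m x - b) <= r ->
  potential x y z <= f x + start_const r.
Proof.
move=> Px gr yr zr br; have [_ df gradL _] := adm.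
have r0 : 0 <= r := le_trans (enorm_ge0 _) gr.
have s0 := sigma_max_ge0 A; have p0 := ltW (p_gt0 Lf_ge0 Lf_lt_p).
have L0 := ltW (LK_gt0 A Lf_ge0 Lf_lt_p rho_ge0).
have dc0 : 0 <= dual_const A G Lf p rho by exact: dual_const_ge0.
have [Pu uvi] := xbarP z y; have [Fs svi] := xstarP z.
have [Kc Klo Kup _] := adm_smooth z y.
set u := xbar z y in Pu uvi *; set s := xstar z in Fs svi *.
set g := start_grad r; set D1 := start_xbar r; set D2 := start_xstar r.
have gle : enorm (DK z y x) <= g.
  rewrite /g /start_grad /prox_grad.
  apply: le_trans (enormD _ _) _; rewrite !mulrDr mulr1 -!addrA.
  apply: lerD => //; rewrite addrA.
  apply: le_trans (enormD _ _) _.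
  have h1 := le_trans (enorm_tr_mulmx_le A y) (ler_wpM2l s0 yr).
  have h2 := ler_wpM2l rho_ge0 (le_trans (enorm_tr_mulmx_le A (A *m x - b))
    (ler_wpM2l s0 br)).
  have h3 := ler_wpM2l p0 zr.
  have := enormD (A^T *m y) (rho *: (A^T *m (A *m x - b))).
  rewrite !enormZ !ger0_norm //; lra.
have g_ge0 : 0 <= g := le_trans (enorm_ge0 _) gle.
have xu : enorm (u - x) <= D1.
  rewrite /D1 /start_xbar -/g ler_pdivlMr // mulrC.
  apply: le_of_sqr_le; rewrite ?enorm_ge0 // sqr_enorm.
  have := strongly_monotone (adm_smooth z y) Pu Px; have := uvi _ Px.
  have := dot_geN (DK z y x) (u - x).
  have := ler_wpM2r (enorm_ge0 (u - x)) gle.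
  rewrite -(opprB u x); move: (u - x) (DK z y u) (DK z y x) => d a a'.
  by rewrite !dotE; lra.
have D1_ge0 : 0 <= D1 := le_trans (enorm_ge0 _) xu.
have xs : enorm (s - x) <= D2.
  apply: le_trans (enorm_triangle u _ _) _; rewrite addrC /D2 /start_xstar -/D1.
  apply: lerD => //; rewrite enorm_distC.
  have h1 := @dual_bound _ _ _ _ A b G h f Lf p rho Lf_ge0 Lf_lt_p rho_ge0
    df gradL xbar xstar xbarP xstarP z y.
  apply: le_trans h1 _; rewrite ler_wpM2l // -/u.
  have -> : A *m u - b = (A *m x - b) + A *m (u - x).
    by rewrite mulmxBr [RHS]addrC addrA subrK.
  apply: le_trans (enormD _ _) _; apply: lerD => //.
  by apply: le_trans (enorm_mulmx_le _ _) _; rewrite ler_wpM2l.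
have D2_ge0 : 0 <= D2 := le_trans (enorm_ge0 _) xs.
have Kx : K z y x <= f x + r ^+ 2 * (1 + rho / 2 + p / 2).
  rewrite prox_lagE.
  have := dot_le y (A *m x - b).
  have := ler_pM (enorm_ge0 _) (enorm_ge0 _) yr br.
  have sq (k : nat) (v : 'cV[R]_k) : enorm v <= r -> dot v v <= r ^+ 2.
    by move=> vr; rewrite -sqr_enorm ler_sqr ?nnegrE ?enorm_ge0.
  have := ler_wpM2l rho_ge0 (sq _ _ br).
  have := ler_wpM2l p0 (sq _ _ zr); rewrite expr2; lra.
have Ku : K z y x - g * D1 <= K z y u.
  have := Klo _ _ Px Pu; have := mulr_ge0 (ltW g0) (dot_ge0 (u - x)).
  have := dot_geN (DK z y x) (u - x).
  have := ler_pM (enorm_ge0 _) (enorm_ge0 _) gle xu; lra.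
have Ks : K z 0 s <= K z y x + g * D2 + LK / 2 * D2 ^+ 2.
  rewrite -(value_dual_indep z y) -/s.
  have := Kup _ _ Px Fs.2; have := dot_le (DK z y x) (s - x).
  have := ler_pM (enorm_ge0 _) (enorm_ge0 _) gle xs.
  have sx2 : dot (s - x) (s - x) <= D2 ^+ 2.
    by rewrite -sqr_enorm ler_sqr ?nnegrE ?enorm_ge0.
  have := ler_wpM2l L0 sx2; lra.
rewrite /potential /start_const -/g -/D1 -/D2 -/u -/s; lra.
Qed.

End Potential.

Lemma decrease_const_gt0 alpha beta : 0 < alpha -> 0 < beta ->
  0 < decrease_const alpha beta.
Proof.
move=> a0 b0; have p0 := p_gt0 Lf_ge0 Lf_lt_p.
have Q1 : 1 <= residual_const A Lf p rho c by exact: residual_const_ge1.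
rewrite mulr_gt0 ?mulr_gt0 ?exprn_gt0 ?(lt_le_trans ltr01 Q1) //.
by rewrite !addr_gt0 ?divr_gt0 ?mulr_gt0.
Qed.

Lemma sqr_sum3_le (a1 a2 a3 : R) :
  (a1 + a2 + a3) ^+ 2 <= 3 * (a1 ^+ 2 + a2 ^+ 2 + a3 ^+ 2).
Proof.
have := sqr_ge0 (a1 - a2); have := sqr_ge0 (a1 - a3); have := sqr_ge0 (a2 - a3).
lra.
Qed.

Lemma sprox_alm_feasible alpha beta x y z : P (x 0%N) ->
  sprox_alm A b G h f rho p c alpha beta x y z -> forall t, P (x t).
Proof. by move=> Px0 run [//|t]; case: (run t) => _ [Px _] _. Qed.

Lemma sprox_alm_decrease alpha beta x y z :
  0 < alpha -> 0 < beta -> beta <= 1 ->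
  4 * c * alpha * (sigma * primal_const A Lf p rho c) ^+ 2 <= 1 ->
  16 * p * beta <= gamma ->
  8 * p * dual_const A G Lf p rho ^+ 2 * beta <= alpha ->
  P (x 0%N) -> sprox_alm A b G h f rho p c alpha beta x y z ->
  exists phi eps : nat -> R,
    [/\ forall t, 0 <= eps t,
        forall t, eps_stationary A b G h f (eps t) (x t.+1) (y t.+1),
        forall t, eps t ^+ 2 <= decrease_const alpha beta * (phi t - phi t.+1),
        forall t, f_lb <= phi t
      & forall r, start_bounded A b G h f r (x 0%N) (y 0%N) (z 0%N) ->
          phi 0%N <= f (x 0%N) + start_const r].
Proof.
move=> a0 b0 b1 alpha_le beta_le beta_alpha Px0 run.
have [F0 df gradL _] := adm.
have g0 : 0 < gamma by exact: gamma_gt0.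
have p0 := p_gt0 Lf_ge0 Lf_lt_p.
have Px := sprox_alm_feasible Px0 run.
have Pconv : segment_closed P by move=> *; exact: polyhedron_segment.
have Fconv : segment_closed (feasible A b G h).
  move=> u v s [/= Au Pu] [/= Av Pv] s0 s1; split; last exact: Pconv.
  by rewrite /= mulmxDr -scalemxAr mulmxBr Au Av subrr scaler0 addr0.
have FP : feasible A b G h `<=` P by move=> u [].
have xbar_ex q : exists u, solves_vi P (DK q.1 q.2) u.
  apply: (exists_solves_vi g0 (adm_smooth q.1 q.2)) => //.
  - exact: closed_polyhedron.
  - by exists (x 0%N).
have [xbar2 xbarP2] := choice xbar_ex.
have xstar_ex q : exists u, solves_vi (feasible A b G h) (DK q 0) u.
  apply: (exists_solves_vi g0 (adm_smooth q 0)) => //.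
  by apply: closedI; [exact: closed_affine|exact: closed_polyhedron].
have [xstar xstarP] := choice xstar_ex.
pose xbar z y := xbar2 (z, y).
have xbarP z0 y0 : solves_vi P (DK z0 y0) (xbar z0 y0) by exact: (xbarP2 (z0, y0)).
pose phi t := potential A b f p rho xbar xstar (x t) (y t) (z t).
pose e t := enorm (x t - x t.+1); pose w t := enorm (x t.+1 - z t).
pose r t := enorm (A *m xbar (z t) (y t.+1) - b).
pose Q := residual_const A Lf p rho c.
have Q0 : 0 <= Q by apply: le_trans ler01 _; exact: residual_const_ge1.
have proj t : is_projection P (x t - c *: DK (z t) (y t.+1) (x t)) (x t.+1).
  by have [_ + _] := run t; rewrite grad_prox_aug_lagrangian.
exists phi, (fun t => Q * (e t + w t + r t)); split=> [t|t|t|t|q].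
- by rewrite mulr_ge0 // !addr_ge0 ?enorm_ge0.
- exact: (@step_eps_stationary _ _ _ _ A b G h f Lf p rho Lf_ge0 Lf_lt_p rho_ge0
    df gradL xbar xbarP c c_gt0 _ _ _ _ (Px t) (proj t)).
- have [yt _ zt] := run t.
  have := @potential_descent _ _ _ _ A b G h f Lf p rho Lf_ge0 Lf_lt_p rho_ge0
    df gradL xbar xstar xbarP xstarP c alpha beta c_gt0 c_lt a0 b0 b1
    _ _ _ _ _ _ (Px t) yt (proj t) zt alpha_le beta_le beta_alpha.
  rewrite -/(phi t) -/(phi t.+1) -!sqr_enorm -/(e t) -/(w t) -/(r t) => desc.
  rewrite exprMn /decrease_const -/Q.
  have pb : 0 < p * beta by rewrite mulr_gt0.
  have eE : e t ^+ 2 = 4 * c * (e t ^+ 2 / (4 * c)) by field; rewrite gt_eqF.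
  have wE : w t ^+ 2 = 8 / (p * beta) * (p * beta / 8 * w t ^+ 2).
    by field; rewrite !gt_eqF.
  have rE : r t ^+ 2 = 2 / alpha * (alpha / 2 * r t ^+ 2) by field; rewrite gt_eqF.
  have X0 : 0 <= e t ^+ 2 / (4 * c) by rewrite divr_ge0 ?sqr_ge0 // mulr_ge0 // ltW.
  have Y0 : 0 <= p * beta / 8 * w t ^+ 2.
    by rewrite mulr_ge0 ?sqr_ge0 // divr_ge0 // ltW.
  have Z0 : 0 <= alpha / 2 * r t ^+ 2 by rewrite mulr_ge0 ?sqr_ge0 // divr_ge0 // ltW.
  have [S1 S2 S3] : [/\ 0 <= 4 * c, 0 <= 8 / (p * beta) & 0 <= 2 / alpha].
    by split; rewrite ?mulr_ge0 ?invr_ge0 ?(ltW c_gt0) ?(ltW pb) ?(ltW a0).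
  rewrite [3 * _]mulrC -(mulrA _ 3) -(mulrA (Q ^+ 2)) -(mulrA 3).
  rewrite ler_wpM2l ?sqr_ge0 //.
  apply: le_trans (sqr_sum3_le _ _ _) _; rewrite ler_pM2l //.
  rewrite {}eE {}wE {}rE.
  apply: le_trans (_ : _ <= (4 * c + 8 / (p * beta) + 2 / alpha) *
    (e t ^+ 2 / (4 * c) + p * beta / 8 * w t ^+ 2 + alpha / 2 * r t ^+ 2)) _.
    move: S1 S2 S3 X0 Y0 Z0; move: (4 * c) (8 / (p * beta)) (2 / alpha) => s1 s2 s3.
    move: (_ / _) (p * beta / 8 * _) (alpha / 2 * _) => X Y Z S1 S2 S3 X0 Y0 Z0.
    have := mulr_ge0 S1 (addr_ge0 Y0 Z0); have := mulr_ge0 S2 (addr_ge0 X0 Z0).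
    have := mulr_ge0 S3 (addr_ge0 X0 Y0); lra.
  by rewrite ler_wpM2l ?addr_ge0 //; lra.
- exact: (potential_ge xbarP xstarP).
- move=> [_ [gr yr zr br]]; exact: (potential_start xbarP xstarP).
Qed.

End Run.

(** * Convergence and complexity *)

Theorem theorem2p4 (R : realType) (m n l : nat)
    (A : 'M[R]_(m, n)) (G : 'M[R]_(l, n)) (Lf p rho c : R)
    (Lf_ge0 : 0 <= Lf) (Lf_lt_p : Lf < p) (p_ge : 3 * Lf <= p)
    (rho_ge0 : 0 <= rho) (c_gt0 : 0 < c)
    (c_lt : c < 1 / (Lf + rho * sigma_max A ^+ 2 + p)) :
  exists alpha' beta' kappa : R,
    [/\ 0 < alpha', 0 < beta', 0 < kappa
      & forall alpha beta : R,
          0 < alpha < alpha' -> 0 < beta < beta' -> beta <= 1 ->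
          beta <= kappa * alpha ->
        [/\ (forall (b : 'cV[R]_m) (h : 'cV[R]_l) (f : 'cV[R]_n -> R)
                    (f_lb : R) (x : nat -> 'cV[R]_n) (y : nat -> 'cV[R]_m)
                    (z : nat -> 'cV[R]_n),
               admissible A b G h f Lf f_lb ->
               sprox_alm A b G h f rho p c alpha beta x y z ->
               forall (xs : 'cV[R]_n) (ys : 'cV[R]_m),
                 cluster ((fun t : nat => (x t, y t)) @ \oo) (xs, ys) ->
                 KKT_point A b G h f xs ys),
            (forall (b : 'cV[R]_m) (h : 'cV[R]_l) (f : 'cV[R]_n -> R)
                    (f_lb : R) (x : nat -> 'cV[R]_n) (y : nat -> 'cV[R]_m)
                    (z : nat -> 'cV[R]_n),
               admissible A b G h f Lf f_lb ->
               sprox_alm A b G h f rho p c alpha beta x y z ->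
               exists2 B : R, 0 < B & stationary_rate A b G h f x y B)
          & (forall f_lb f0 r : R, exists2 B : R, 0 < B &
               forall (b : 'cV[R]_m) (h : 'cV[R]_l) (f : 'cV[R]_n -> R)
                      (x : nat -> 'cV[R]_n) (y : nat -> 'cV[R]_m)
                      (z : nat -> 'cV[R]_n),
                 admissible A b G h f Lf f_lb ->
                 sprox_alm A b G h f rho p c alpha beta x y z ->
                 f (x 0%N) = f0 ->
                 start_bounded A b G h f r (x 0%N) (y 0%N) (z 0%N) ->
                 stationary_rate A b G h f x y B)]].
Proof.
have p0 : 0 < p by exact: p_gt0 Lf_lt_p.
have g0 : 0 < p - Lf by rewrite subr_gt0.
have cLK : c * (Lf + rho * sigma_max A ^+ 2 + p) <= 1.
  by rewrite ltW // -ltr_pdivlMr //; exact: LK_gt0.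
pose s := sigma_max A * primal_const A Lf p rho c.
pose dc := dual_const A G Lf p rho.
have alpha'_gt0 : 0 < 4 * c * s ^+ 2 + 1.
  by rewrite ltr_wpDl // mulr_ge0 ?sqr_ge0 // mulr_ge0 // ltW.
have kappa_gt0 : 0 < 8 * p * dc ^+ 2 + 1.
  by rewrite ltr_wpDl // mulr_ge0 ?sqr_ge0 // mulr_ge0 // ltW.
(* One threshold for each step size condition of [potential_descent]; the added
   1 keeps the denominators positive. *)
exists (4 * c * s ^+ 2 + 1)^-1, ((p - Lf) / (16 * p)), (8 * p * dc ^+ 2 + 1)^-1.
split; rewrite ?invr_gt0 ?divr_gt0 ?mulr_gt0 //.
move=> alpha beta /andP[a0 a_lt] /andP[b0 b_lt] b1 b_le.
have alpha_le : 4 * c * alpha * s ^+ 2 <= 1.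
  have : alpha * (4 * c * s ^+ 2 + 1) <= 1 by rewrite -ler_pdivlMr ?div1r // ltW.
  by move: a0; lra.
have beta_le : 16 * p * beta <= p - Lf.
  by have := ltW b_lt; rewrite ler_pdivlMr ?mulr_gt0 // mulrC.
have beta_alpha : 8 * p * dc ^+ 2 * beta <= alpha.
  by move: b_le; rewrite mulrC ler_pdivlMr // => b_le; move: b0; lra.
have run b h f f_lb x y z (adm : admissible A b G h f Lf f_lb) :=
  sprox_alm_decrease Lf_ge0 Lf_lt_p rho_ge0 c_gt0 cLK adm (x := x) (y := y)
    (z := z) a0 b0 b1 alpha_le beta_le beta_alpha.
have D0 := decrease_const_gt0 A Lf_ge0 Lf_lt_p rho_ge0 c_gt0 a0 b0.
(* The starting point may lie outside the polyhedron, where [f] is not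
   controlled; the first step enters it. *)
have tail b h f (x : nat -> 'cV[R]_n) (y : nat -> 'cV[R]_m)
    (z : nat -> 'cV[R]_n) : sprox_alm A b G h f rho p c alpha beta x y z ->
  polyhedron G h (x 1%N) /\ sprox_alm A b G h f rho p c alpha beta
    (fun t => x t.+1) (fun t => y t.+1) (fun t => z t.+1).
  by move=> alg; split=> [|t]; [case: (alg 0%N) => _ []|exact: alg].
split.
- move=> b h f f_lb x y z adm alg xs ys.
  have [Px1 alg1] := tail _ _ _ _ _ _ alg.
  have [phi [eps [eps0 epsP dec lb _]]] := run _ _ _ _ _ _ _ adm Px1 alg1.
  have [_ _ gradL _] := adm.
  apply: (cluster_KKT_point Lf_ge0 gradL) => d d0.
  have [T TP] := residual_cvg0 D0 eps0 dec lb d0.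
  exists T.+2 => -[//|[//|t]] Tt; split.
    exact: (sprox_alm_feasible Px1 alg1 t.+1).
  by apply: eps_stationary_le (epsP t); exact: TP.
- move=> b h f f_lb x y z adm alg.
  have [Px1 alg1] := tail _ _ _ _ _ _ alg.
  have [phi [eps [eps0 epsP dec lb _]]] := run _ _ _ _ _ _ _ adm Px1 alg1.
  pose B := Num.max 1 (decrease_const A Lf p rho c alpha beta * (phi 0%N - f_lb)).
  have B0 : 0 < B by rewrite lt_max ltr01.
  apply: (stationary_rate_shift Px1 B0).
  apply: (stationary_rate_of_decrease D0 eps0 epsP dec lb B0).
  by rewrite le_max lexx orbT.
- move=> f_lb f0 r.
  pose B := Num.max 1 (decrease_const A Lf p rho c alpha beta *
    (f0 + start_const A G Lf p rho r - f_lb)).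
  have B0 : 0 < B by rewrite lt_max ltr01.
  exists B => // b h f x y z adm alg f0E start.
  have [phi [eps [eps0 epsP dec lb start_le]]] := run _ _ _ _ _ _ _ adm start.1 alg.
  apply: (stationary_rate_of_decrease D0 eps0 epsP dec lb B0).
  rewrite le_max; apply/orP; right; rewrite ler_wpM2l ?(ltW D0) // lerD2r -f0E.
  exact: start_le.
Qed.
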